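(* Let $\Omega\subset\mathbb{R}^N$ be an open bounded set, which is connected. Let $s\in(0,1)$, $1<p<\infty$ and let $u\in W^{s,p}_0(\Omega)$ be a weak supersolution, i.e. \[ \int_{\mathbb{R}^N}\int_{\mathbb{R}^N} \frac{|u(x)-u(y)|^{p-2}(u(x)-u(y))}{|x-y|^{N+s\,p}}\,(\varphi(x)-\varphi(y))\, dx\,dy \ge 0 \quad \text{for all } \varphi \in C_0^\infty(\Omega),\ \varphi\ge0, \] such that $u\ge 0$ in $\Omega$. Suppose that $u\not\equiv 0$ in $\Omega$ (i.e. $u$ is not almost everywhere equal to $0$ in $\Omega$). Then $u>0$ almost everywhere in $\Omega$.
   Context: $W^{s,p}_0(\Omega)$ denotes the completion of $C^\infty_0(\Omega)$ (functions extended by $0$ to $\mathbb{R}^N$) with respect to the norm \[ \|u\|_{W^{s,p}_0(\Omega)}=\left(\int_{\mathbb{R}^N}\int_{\mathbb{R}^N} \frac{|u(x)-u(y)|^{p}}{|x-y|^{N+s\,p}}\, dx\, dy\right)^\frac{1}{p}; \] its elements are regarded as functions on $\mathbb{R}^N$ vanishing outside $\Omega$. The expression $|a|^{p-2}a$ is understood to be $0$ for $a=0$. *)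

(* Defs.v *)
From HB Require Import structures.
From mathcomp Require Import all_boot all_order all_algebra.
From mathcomp Require Import all_classical all_reals all_analysis.

Set Implicit Arguments.
Unset Strict Implicit.
Unset Printing Implicit Defensive.

Import Order.TTheory GRing.Theory Num.Theory.
Import numFieldNormedType.Exports.

Local Open Scope classical_set_scope.
Local Open Scope ring_scope.

Definition rV_display : measure_display.
Proof. exact: default_measure_display. Qed.

Section measurable_rV.
Context {R : realType} {n : nat}.

(* Product sigma-algebra on R^n; since R is second countable, it is the Borel
   sigma-algebra of the topology of 'rV[R]_n. *)
Let coors (i : 'I_n) (x : 'rV[R]_n) : measurableTypeR R := x ord0 i.

Let rV_set0 : g_sigma_preimage coors set0.
Proof. exact: sigma_algebra0. Qed.

Let rV_setC A : g_sigma_preimage coors A -> g_sigma_preimage coors (~` A).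
Proof. exact: sigma_algebraC. Qed.

Let rV_bigcup (F : (set 'rV[R]_n)^nat) :
  (forall i, g_sigma_preimage coors (F i)) ->
  g_sigma_preimage coors (\bigcup_i (F i)).
Proof. exact: sigma_algebra_bigcup. Qed.

HB.instance Definition _ := @isMeasurable.Build rV_display
  'rV[R]_n (g_sigma_preimage coors) rV_set0 rV_setC rV_bigcup.

Lemma measurable_coord (i : 'I_n) :
  measurable_fun [set: 'rV[R]_n] (fun x => x ord0 i : measurableTypeR R).
Proof.
move=> _ Y mY; rewrite setTI; apply: sub_sigma_algebra => /=.
rewrite -bigcup_seq/=; exists i => /=; first by rewrite mem_index_enum.
by exists Y => //; rewrite setTI.
Qed.

Lemma measurable_fun_rVP d (T : measurableType d) (f : T -> 'rV[R]_n) :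
  (forall i, measurable_fun [set: T] (fun t => f t ord0 i : measurableTypeR R)) ->
  measurable_fun [set: T] f.
Proof.
move=> mf _ Y mY.
have sG : sigma_algebra [set: 'rV[R]_n] [set B | measurable (f @^-1` B)].
  split=> /=.
  - by rewrite preimage_set0.
  - by move=> A mA; rewrite setTD preimage_setC; exact: measurableC.
  - by move=> F mF; rewrite preimage_bigcup; exact: bigcup_measurable.
rewrite setTI; apply: (smallest_sub sG _ mY) => A.
rewrite -bigcup_seq/= => -[i _ [B mB <-]]; rewrite setTI /=.
by have := mf i measurableT B mB; rewrite setTI.
Qed.

End measurable_rV.

Section cons_rV.
Context {R : realType} {n : nat}.

Definition cons_rV (z : measurableTypeR R * 'rV[R]_n) : 'rV[R]_n.+1 :=
  row_mx (const_mx z.1 : 'rV[R]_1) z.2.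

Definition uncons_rV (x : 'rV[R]_n.+1) : measurableTypeR R * 'rV[R]_n :=
  (x ord0 ord0, rsubmx (x : 'rV[R]_(1 + n))).

Lemma cons_rVK : cancel cons_rV uncons_rV.
Proof.
move=> [a v]; rewrite /uncons_rV /cons_rV /= row_mxKr; congr pair.
by rewrite mxE; case: splitP => // j _; rewrite mxE.
Qed.

Lemma measurable_cons_rV : measurable_fun setT cons_rV.
Proof.
apply: measurable_fun_rVP => i.
case: (split_ordP (i : 'I_(1 + n))) => j ->.
  rewrite (_ : (fun _ => _) = fst); first exact: measurable_fst.
  apply/funext => t; rewrite /cons_rV.
  exact: etrans (row_mxEl _ _ _ _) (mxE _ _ _ _).
rewrite (_ : (fun _ => _) = (fun x : 'rV[R]_n => x ord0 j) \o snd).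
  by apply: measurableT_comp; [exact: measurable_coord|exact: measurable_snd].
by apply/funext => t; rewrite /cons_rV; exact: row_mxEr.
Qed.

Lemma measurable_uncons_rV : measurable_fun setT uncons_rV.
Proof.
apply/measurable_fun_pair => /=; first exact: measurable_coord.
apply: measurable_fun_rVP => i; under eq_fun do rewrite mxE.
exact: measurable_coord.
Qed.

End cons_rV.

Section lebesgue_rV.
Context {R : realType}.
Local Open Scope ereal_scope.

Section step.
Context {n : nat}.
Variable mu : {sigma_finite_measure set 'rV[R]_n -> \bar R}.

Definition lebesgue_rV_step : set 'rV[R]_n.+1 -> \bar R :=
  pushforward (@lebesgue_measure R \x mu) cons_rV.

Let step0 : lebesgue_rV_step set0 = 0.
Proof. by rewrite /lebesgue_rV_step /pushforward preimage_set0 measure0. Qed.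

Let step_ge0 A : 0 <= lebesgue_rV_step A.
Proof. exact: (@measure_ge0 _ _ _ (@lebesgue_measure R \x mu)). Qed.

Let step_sigma_additive : semi_sigma_additive lebesgue_rV_step.
Proof.
have mcons (A : set 'rV[R]_n.+1) : measurable A -> measurable (cons_rV @^-1` A).
  by move=> mA; rewrite -[X in measurable X]setTI; exact: measurable_cons_rV.
move=> F mF tF mUF; rewrite /lebesgue_rV_step /pushforward preimage_bigcup.
apply: (@measure_semi_sigma_additive _ _ _ (@lebesgue_measure R \x mu)).
- by move=> i; exact: mcons.
- apply/trivIsetP => /= i j _ _ ij; rewrite -preimage_setI.
  by move/trivIsetP : tF => /(_ _ _ _ _ ij) ->//; rewrite preimage_set0.
- by rewrite -preimage_bigcup; exact: mcons.
Qed.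

HB.instance Definition _ := isMeasure.Build _ _ _ lebesgue_rV_step
  step0 step_ge0 step_sigma_additive.

Let step_sigma_finite : sigma_finite setT lebesgue_rV_step.
Proof.
have /sigma_finiteP[F [FT ndF Foo]] := sigma_finiteT (@lebesgue_measure R).
have /sigma_finiteP[G [GT ndG Goo]] := sigma_finiteT mu.
exists (fun k => uncons_rV @^-1` (F k `*` G k)) => [|k].
  rewrite -preimage_bigcup (_ : \bigcup_k (F k `*` G k) = setT) ?preimage_setT//.
  rewrite -setXTT FT GT predeqE => -[x y]; split.
    by move=> [k _ []/= ? ?]; split; exists k.
  move=> [/= [k _ Fkx] [j _ Gjy]]; exists (maxn k j) => //; split.
  - by move: x Fkx; exact/subsetPset/ndF/leq_maxl.
  - by move: y Gjy; exact/subsetPset/ndG/leq_maxr.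
have [mF Fk] := Foo k; have [mG Gk] := Goo k.
split.
  rewrite -[X in measurable X]setTI.
  by apply: measurable_uncons_rV => //; exact: measurableX.
rewrite /lebesgue_rV_step /pushforward -comp_preimage.
rewrite (_ : uncons_rV \o cons_rV = id); last by apply/funext; exact: cons_rVK.
by rewrite preimage_id product_measure1E// lte_mul_pinfty// ge0_fin_numE.
Qed.

HB.instance Definition _ := Measure_isSigmaFinite.Build _ _ _ lebesgue_rV_step
  step_sigma_finite.

End step.

(* N-dimensional Lebesgue measure, through R^(n+1) = R x R^n; on the one-point
   space R^0 it is the unit mass. *)
Fixpoint lebesgue_rV (n : nat) : {sigma_finite_measure set 'rV[R]_n -> \bar R} :=
  match n with
  | 0 => \d_(0%R : 'rV[R]_0)
  | n'.+1 => lebesgue_rV_step (lebesgue_rV n')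
  end.

Lemma lebesgue_rV_box n (a b : 'rV[R]_n) : (forall i, a ord0 i <= b ord0 i)%R ->
  lebesgue_rV n [set x | forall i, x ord0 i \in `[a ord0 i, b ord0 i]] =
  (\prod_(i < n) (b ord0 i - a ord0 i))%:E.
Proof.
elim: n a b => [|n IH] a b ab.
  rewrite big_ord0 /= diracE mem_set //= => -[].
  by [].
rewrite /= /lebesgue_rV_step /pushforward.
have coord0 (x : 'rV[R]_n.+1) : (uncons_rV x).1 = x ord0 ord0 by [].
have coordS (x : 'rV[R]_n.+1) j :
    (uncons_rV x).2 ord0 j = x ord0 (lift ord0 j).
  by rewrite mxE; congr (x _ _); exact: val_inj.
have boxE (x : 'rV[R]_n.+1) : (forall i, x ord0 i \in `[a ord0 i, b ord0 i]) <->
    (uncons_rV x).1 \in `[a ord0 ord0, b ord0 ord0] /\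
    forall j, (uncons_rV x).2 ord0 j \in
      `[(uncons_rV a).2 ord0 j, (uncons_rV b).2 ord0 j].
  split=> [xab|[x0 xS] i].
    by split=> [|j]; [rewrite coord0|rewrite !coordS]; exact: xab.
  by case: (unliftP ord0 i) => [j|] ->; rewrite -?coordS.
have -> : cons_rV @^-1` [set x | forall i, x ord0 i \in `[a ord0 i, b ord0 i]] =
  [set` `[a ord0 ord0, b ord0 ord0]] `*`
  [set x : 'rV[R]_n | forall i, x ord0 i \in
     `[(uncons_rV a).2 ord0 i, (uncons_rV b).2 ord0 i]].
  apply/seteqP; split=> z /=.
    by move=> /boxE; rewrite cons_rVK.
  by move=> zab; apply/boxE; rewrite cons_rVK.
rewrite product_measure1E /=; last 2 first.
- exact: measurable_itv.
- have -> : [set x : 'rV[R]_n | forall i, x ord0 i \in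
     `[(uncons_rV a).2 ord0 i, (uncons_rV b).2 ord0 i]] =
     \bigcap_(i in [set: 'I_n]) ((fun x : 'rV[R]_n => x ord0 i) @^-1`
        [set` `[(uncons_rV a).2 ord0 i, (uncons_rV b).2 ord0 i]]).
    by apply/seteqP; split=> x /= h; [move=> i _|move=> i]; exact: h.
  apply: fin_bigcap_measurable => // i _.
  by rewrite -[X in measurable X]setTI; apply: measurable_coord.
rewrite IH; last by move=> i; rewrite !coordS.
rewrite lebesgue_measure_itv /= lte_fin big_ord_recl EFinM; congr (_ * _).
  by case: ltgtP (ab ord0) => // ->; rewrite subrr.
by congr EFin; apply: eq_bigr => i _; rewrite !coordS.
Qed.

End lebesgue_rV.

Arguments lebesgue_rV {R} n.

Section fractional_sobolev.
Context {R : realType} {N : nat}.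
Local Notation mu := (@lebesgue_rV R N).

(* The library norm `|x| on 'rV[R]_N is the sup norm. *)
Definition enorm (x : 'rV[R]_N) : R := Num.sqrt (\sum_(i < N) x ord0 i ^+ 2).

Definition partial (i : 'I_N) (f : 'rV[R]_N -> R) : 'rV[R]_N -> R :=
  'D_(delta_mx ord0 i) f.

(* Partial derivatives of every order exist and are continuous. *)
Definition smooth (f : 'rV[R]_N -> R) : Prop :=
  forall l : seq 'I_N, continuous (foldr partial f l) /\
    forall (i : 'I_N) (x : 'rV[R]_N),
      derivable (foldr partial f l) x (delta_mx ord0 i).

Definition test_function (Omega : set 'rV[R]_N) (phi : 'rV[R]_N -> R) : Prop :=
  [/\ smooth phi,
      compact (closure [set x | phi x != 0]) &
      closure [set x | phi x != 0] `<=` Omega].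

(* On the null diagonal x = y the quotient takes the value 0, as 0 `^ a = 0 for
   a <> 0 and division by 0 gives 0. *)
Definition gagliardo_norm (s p : R) (u : 'rV[R]_N -> R) : \bar R :=
  (\int[mu \x mu]_z
    (`|u z.1 - u z.2| `^ p / enorm (z.1 - z.2) `^ (N%:R + s * p))%:E)%E
  `^ p^-1.

(* W^{s,p}_0(Omega): a class in the completion of the test functions is
   identified with its limit u in the Gagliardo norm. The limit is unique up to
   null sets because u vanishes outside Omega, and it exists, for bounded
   Omega, by the fractional Poincare inequality. *)
Definition sobolev0 (s p : R) (Omega : set 'rV[R]_N) (u : 'rV[R]_N -> R) : Prop :=
  [/\ measurable_fun [set: 'rV[R]_N] u,
      {ae mu, forall x, ~ Omega x -> u x = 0},
      (gagliardo_norm s p u < +oo)%E &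
      exists phi : nat -> 'rV[R]_N -> R,
        (forall n, test_function Omega (phi n)) /\
        gagliardo_norm s p (phi n \- u) @[n --> \oo] --> 0%E].

(* |a|^(p-2) a, which is 0 for a = 0 *)
Definition signed_power (p a : R) : R := `|a| `^ (p - 2) * a.

Definition frac_plaplacian_form (s p : R) (u phi : 'rV[R]_N -> R) : \bar R :=
  (\int[mu \x mu]_z
    (signed_power p (u z.1 - u z.2) / enorm (z.1 - z.2) `^ (N%:R + s * p)
     * (phi z.1 - phi z.2))%:E)%E.

Definition weak_supersolution (s p : R) (Omega : set 'rV[R]_N)
    (u : 'rV[R]_N -> R) : Prop :=
  forall phi : 'rV[R]_N -> R,
    test_function Omega phi -> (forall x, 0 <= phi x) ->
    (0 <= frac_plaplacian_form s p u phi)%E.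

End fractional_sobolev.

(* Main.v *)
Require Import Defs.
From mathcomp Require Import all_boot all_order all_algebra.
From mathcomp Require Import all_classical all_reals all_analysis.
From mathcomp Require Import measurable_realfun ring lra.
Import Order.TTheory GRing.Theory Num.Theory.
Import numFieldNormedType.Exports.
Local Open Scope classical_set_scope.
Local Open Scope ring_scope.
Set Implicit Arguments.
Unset Strict Implicit.
Unset Printing Implicit Defensive.

(** Test the supersolution inequality with eta * F_j(u), where eta >= 0 is a bump
    function and F_j(t) = 1 / (1 + (j t)^2). With
    w(x, y) = |u(x) - u(y)|^(p-2) (u(x) - u(y)) / |x - y|^(N + s p), the integrand
    w(x, y) (eta(x) F_j(u(x)) - eta(y) F_j(u(y))) is the sum of a nonpositive
    term, which on {u(x) > 0} x {u(y) = 0} is at most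
    - w(x, y) eta(y) (1 - F_1(u(x))) uniformly in j, and of an error bounded by
    |w(x, y)| |eta(x) - eta(y)| F_j(u(x) - u(y)), which is dominated by an
    integrable function and tends to 0 as j grows. Hence
    {u > 0} x {u = 0, eta > 0} is a null set, and so is one of its two factors.

    The functions eta * F_j(phi_n), with phi_n the test functions approximating u
    in the Gagliardo seminorm, are smooth with compact support; dominated
    convergence along a fast subsequence gives the inequality for eta * F_j(u). *)

(** * Euclidean topology and the product sigma-algebra *)

(** The inequality is available only for smooth tests, so [u] itself cannot be inserted in [F_j],
    and neither can a negative power of the approximants, which may change sign. The rational
    profile avoids this: its denominator never vanishes, so [eta * F_j(phi_n)] is smooth for every
    test function [phi_n]. The rest of the argument uses that [F_j] is even, decreasing in [|t|],
    Lipschitz, bounded by 1, equal to 1 at 0, and tends to 0 elsewhere.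

    The seminorm controls increments only, whereas [F_j(phi_n)] depends on values. Values are
    recovered by comparison with points of a box outside [Omega], where [u] vanishes almost
    everywhere and every [phi_n] vanishes.

    The sign of the main term comes from writing, for [u(y) <= u(x)], the increment of the test as
    [(eta(x) - eta(y)) F_j(u(x)) - eta(y) (F_j(u(y)) - F_j(u(x)))]. Since
    [0 <= u(x) - u(y) <= u(x)], the first part is controlled by [F_j(u(x) - u(y))].

    The positivity set is taken in the whole space, so each bump compares the zeros of [u] near its
    centre with all of [{u > 0}] at once. Countably many bumps then exhaust [Omega]. *)

Section rV_topology.
Context {R : realType} {N : nat}.
Implicit Types (O A : set 'rV[R]_N) (x y c : 'rV[R]_N).

Lemma ball_rVP c e x : ball c e x <-> 0 < e /\ forall i, `|c ord0 i - x ord0 i| < e.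
Proof.
split=> [[e0 h]|[e0 h]]; first by split => // i; exact: h.
by split => // i j; rewrite !ord1; exact: h.
Qed.

Lemma rat_approx (x : 'rV[R]_N) (e : R) : 0 < e ->
  exists q : 'rV[rat]_N, ball (map_mx ratr q : 'rV[R]_N) e x.
Proof.
move=> e0.
have h (i : 'I_N) : exists q : rat, x ord0 i - e < ratr q < x ord0 i.
  have /rat_in_itvoo[q] : x ord0 i - e < x ord0 i by rewrite ltrBlDr ltrDl.
  by rewrite in_itv /=; exists q.
exists (\row_i sval (cid (h i))); apply/ball_rVP; split => // i.
rewrite !mxE; case: cid => q /= /andP[q1 q2].
by rewrite ltr_norml; apply/andP; split; lra.
Qed.

(** Rational centres and radii [1/(m+1)] form a countable family, enumerated here through [pickle].
    The dilation [l] reserves room inside [O] for the support of a bump that is positive on the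
    undilated ball. *)
Lemma open_rV_cover O (l : R) : open O -> 1 <= l ->
  exists (D : set nat) (c : nat -> 'rV[R]_N) (r : nat -> R),
    (forall k, D k -> 0 < r k /\ ball (c k) (l * r k) `<=` O) /\
    O `<=` \bigcup_(k in D) ball (c k) (r k).
Proof.
move=> oO l1.
pose T := ('rV[rat]_N * nat)%type.
pose dec (k : nat) : T := odflt (0, 0%N) (unpickle k).
pose c k : 'rV[R]_N := map_mx ratr (dec k).1.
pose r k : R := (dec k).2.+1%:R^-1.
exists [set k | ball (c k) (l * r k) `<=` O], c, r; split.
  by move=> k /= h; split => //; rewrite invr_gt0.
move=> x Ox; have [e /= e0 eO] : \forall e \near 0^'+, ball x e `<=` O.
  by apply/open_subball.
have lp : 0 < l + 1 by lra.
have eO' : ball x (e / 2) `<=` O.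
  by apply: eO => /=; rewrite ?opprK ?sub0r ?normrN; [rewrite gtr0_norm; lra|lra].
(* With a centre at distance less than [1/(m+1)] from [x], the dilated ball lies within
   [(1 + l)/(m+1)] of [x]; this is made at most [e / 2]. *)
have [m _ /(_ m (leqnn m)) hm] :=
  @near_infty_natSinv_lt R (PosNum (divr_gt0 (divr_gt0 e0 (ltr0n R 2)) lp)).
have [q hq] := @rat_approx x (m.+1%:R^-1) ltac:(by rewrite invr_gt0).
exists (pickle ((q, m) : T)); rewrite /= /c /r /dec pickleK //=.
move=> y hy; apply: eO'.
apply: (@le_ball _ _ _ (m.+1%:R^-1 + l * m.+1%:R^-1)).
  by move: hm => /=; rewrite ltr_pdivlMr// => /ltW; rewrite mulrDr mulr1 mulrC addrC.
exact: ball_triangle (ball_sym hq) hy.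
Qed.

Lemma measurable_ball_rV c (e : R) : measurable (ball c e).
Proof.
have [e0|e0] := ltP 0 e; last first.
  rewrite (_ : ball c e = set0); first exact: measurable0.
  by apply/seteqP; split => // x /ball_rVP[]; rewrite ltNge e0.
rewrite (_ : ball c e = \bigcap_(i in [set: 'I_N])
   ((fun x : 'rV[R]_N => x ord0 i) @^-1` ball (c ord0 i : R) e)).
  apply: fin_bigcap_measurable => // i _.
  rewrite -[X in measurable X]setTI; apply: measurable_coord => //.
  by apply: open_measurable; exact: ball_open.
apply/seteqP; split => x; first by move=> /ball_rVP[_ h] i _; exact: h.
by move=> h; apply/ball_rVP; split => // i; exact: h.
Qed.

(** The sigma-algebra is generated by the coordinates, and sup-norm balls are finite intersections
    of coordinate preimages; a countable cover by such balls does the rest. *)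
Lemma open_rV_measurable O : open O -> measurable O.
Proof.
move=> oO; have [D [c [r [h1 h2]]]] := open_rV_cover oO (lexx 1).
suff -> : O = \bigcup_(k in D) ball (c k) (r k).
  by apply: bigcup_measurable => k _; exact: measurable_ball_rV.
apply/seteqP; split => // x [k Dk kx].
by apply: (h1 k Dk).2; rewrite mul1r.
Qed.

Lemma continuous_rV_measurable (f : 'rV[R]_N -> R) : continuous f ->
  measurable_fun setT f.
Proof.
move=> cf; apply: (measurability _ (RGenOpens.measurableE R)).
move=> _ [_ [a [b ->] <-]]; rewrite setTI; apply: open_rV_measurable.
by apply: open_comp => //; exact: interval_open.
Qed.

Lemma negligible_open_cover (mu : {measure set 'rV[R]_N -> \bar R}) O A (l : R) :
  open O -> 1 <= l ->
  (forall c (r : R), 0 < r -> ball c (l * r) `<=` O ->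
     mu.-negligible (A `&` ball c r)) ->
  mu.-negligible (A `&` O).
Proof.
move=> oO l1 h; have [D [c [r [h1 h2]]]] := open_rV_cover oO l1.
apply: (@negligibleS _ _ _ _ (\bigcup_k if k \in D then A `&` ball (c k) (r k) else set0)).
  move=> x [Ax /h2[k Dk kx]]; exists k => //.
  by rewrite mem_set.
apply: negligible_bigcup => k; case: ifPn => [/set_mem Dk|_]; last exact: negligible_set0.
by have [? ?] := h1 k Dk; exact: h.
Qed.

End rV_topology.

(** * Smooth bump functions *)

Section flat_functions.
Context {R : realType}.

(* The derivatives of exp(-1/t) are linear combinations of these functions. *)
Definition flat (k : nat) (t : R) : R :=
  if 0 < t then t ^- k * expR (- t^-1) else 0.

Lemma flat_ge0 k t : 0 <= flat k t.
Proof.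
rewrite /flat; case: ifPn => // t0.
by rewrite mulr_ge0 ?expR_ge0// invr_ge0 exprn_ge0// ltW.
Qed.

(** With [m = k + 1], [exp(1/t) = exp(1/(m t))^m >= (m t)^(-m)], whence the constant [m^m]. This
    gives the derivative of [flat] at 0. *)
Lemma flat_le_norm k : exists2 C, 0 <= C & forall t, flat k t <= C * `|t|.
Proof.
exists (k.+1%:R ^+ k.+1); first by rewrite exprn_ge0.
move=> t; rewrite /flat; case: ifPn => [t0|_]; last by rewrite mulr_ge0// exprn_ge0.
have tk0 : 0 < t ^+ k by rewrite exprn_gt0.
rewrite gtr0_norm// ler_pdivrMl// expRN.
have -> : t ^+ k * (k.+1%:R ^+ k.+1 * t) = (k.+1%:R * t) ^+ k.+1.
  by rewrite exprMn (exprSr t); ring.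
rewrite invf_ple ?posrE ?expR_gt0 ?exprn_gt0 ?mulr_gt0//.
rewrite -exprVn -[in leRHS](_ : k.+1%:R * (k.+1%:R * t)^-1 = t^-1); last first.
  by rewrite invfM mulrA divff ?mul1r.
rewrite expRM_natl lerXn2r ?nnegrE ?expR_ge0//.
  by rewrite invr_ge0 mulr_ge0// ltW.
by apply: le_trans (expR_ge1Dx _); rewrite lerDr.
Qed.

Lemma is_derive_flat k (t : R) :
  is_derive t 1 (flat k) (flat k.+2 t - k%:R * flat k.+1 t).
Proof.
have [t0|t0|->] := ltgtP t 0.
- apply: (@near_eq_is_derive _ _ _ (cst 0)).
    near=> z; rewrite /flat ifF//=; apply/negbTE; rewrite -leNgt ltW//.
    by near: z; exact: lt_nbhsl.
  by apply: is_derive_eq; rewrite /flat !ifF ?mulr0 ?subr0// lt_gtF.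
- apply: (@near_eq_is_derive R R R (fun z : R => z ^- k * expR (- z^-1) : R)).
    near=> z; rewrite /flat ifT//.
    by near: z; exact: lt_nbhsr.
  have tn0 : t != 0 by rewrite gt_eqF.
  have dV : is_derive t 1 (fun z : R => z^-1) (- t ^- 2).
    apply: DeriveDef; first exact: derivableV.
    by rewrite deriveV// derive_id scaler1.
  have dE : is_derive t 1 (fun z : R => expR (- z^-1)) (t ^- 2 * expR (- t^-1)).
    have := @is_derive1_comp _ (@expR R) (fun z => - z^-1) t _ _ (is_derive_expR _) (is_deriveN dV).
    by rewrite opprK mulrC.
  have dX : is_derive t 1 (fun z : R => z ^- k) (- k%:R * t ^- k.+1).
    have := is_deriveX k dV.
    rewrite /= (_ : _ ^+ k = (fun z : R => z ^- k)); last first.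
      by apply/funext => z; rewrite fctE exprVn.
    move/is_derive_eq; apply.
    case: k {dV dE} => [|k]; first by rewrite !mul0r oppr0 scale0r mul0r.
    by rewrite /= scalerN -[LHS]/(- (k.+1%:R * t^-1 ^+ k * t ^- 2)) -!exprVn mulNr -mulrA -exprD addn2.
  apply: is_derive_eq (is_deriveM dX dE) _.
  rewrite /flat t0 -[LHS]/(t ^- k * (t ^- 2 * expR (- t^-1)) + expR (- t^-1) * (- k%:R * t ^- k.+1)).
  by rewrite -!exprVn !exprS; ring.
(* At 0 the difference quotient [flat k h / h] is [flat k.+1 h], also for [h < 0] where both vanish,
   and the linear bound squeezes it to 0. *)
- rewrite /flat ltxx mulr0 subr0 -/(flat k).
  have [C C0 hC] := flat_le_norm k.+1.
  have h0 : flat k 0 = 0 by rewrite /flat ltxx.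
  suff : h^-1 *: (flat k (h *: 1 + 0) - flat k 0) @[h --> 0^'] --> (0:R).
    move=> c; apply: DeriveDef; last exact: cvg_lim c.
    by apply/cvg_ex; exists 0.
  apply: norm_cvg0.
  apply: (@squeeze_cvgr _ _ _ _ (cst 0) (fun h => C * `|h|)).
  + near=> h; rewrite normr_ge0 /= h0 subr0 addr0.
    rewrite -[h *: 1]/(h * 1) mulr1 -[_ *: _]/(_ * _).
    have -> : h^-1 * flat k h = flat k.+1 h.
      rewrite /flat; case: ifPn => [hp|_]; last by rewrite mulr0.
      by rewrite mulrA exprS invfM.
    by rewrite ger0_norm ?flat_ge0.
  + exact: cvg_cst.
  + have : C * `|h| @[h --> (0:R)] --> C * `|0 : R|.
      by apply: cvgM; [exact: cvg_cst|exact: cvg_norm].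
    rewrite normr0 mulr0 => cc; apply: cvg_trans cc.
    exact/cvg_app/cvg_within.
Unshelve. all: by end_near. Qed.

(** Restriction to the line [h *: v + x] reduces this to the one-variable chain rule, so a
    derivative of [g] in the single direction [v] suffices; [smooth] provides exactly such
    coordinate derivatives. *)
Lemma is_derive_comp_dir (V : normedModType R) (psi : R -> R) (g : V -> R)
    (x v : V) (dpsi dg : R) :
  is_derive (g x) 1 psi dpsi -> is_derive x v g dg ->
  is_derive x v (psi \o g) (dpsi * dg).
Proof.
move=> [dp <-] [dgx <-].
have dl : derivable (fun h : R => g (h *: v + x)) 0 1 by case: (derivable1P g x v) => + _; exact.
have E (f : V -> R) : 'D_v f x = 'D_1 (fun h : R => f (h *: v + x)) 0.
  rewrite /derive; set g1 := fun h => h^-1 *: _; set g2 := fun h => h^-1 *: _.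
  suff -> : g1 = g2 by []; rewrite funeqE /g1 /g2 => h /=.
  by rewrite addr0 scale0r add0r [_%:A]mulr1.
have e0 : g (0 *: v + x) = g x by rewrite scale0r add0r.
have dp0 : derivable psi (g (0 *: v + x)) 1 by rewrite e0.
have := @is_derive1_comp _ psi (fun h : R => g (h *: v + x)) 0 _ _
  (derivableP dp0) (derivableP dl).
move=> [d1 d2]; apply: DeriveDef; first exact: (derivable1P (psi \o g) x v).2.
by rewrite E (E g) -e0 -d2.
Qed.

Lemma flat_lipschitz0 (a b : R) : `|flat 0 a - flat 0 b| <= `|a - b|.
Proof.
(* The derivative of [flat 0] is [flat 2]. With [x = 1/t] the bound reads [x^2 <= exp x], which
   follows from [exp(x/4) >= 1 + x/4] and [(1 + x/4)^2 >= x], the latter being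
   [(1 - x/4)^2 >= 0]. *)
have bd t : 0 <= flat 2 t <= 1.
  rewrite flat_ge0 /flat; case: ifPn => [t0|_]; last exact: ler01.
  rewrite expRN -invfM invf_le1 ?mulr_gt0 ?expR_gt0 ?exprn_gt0//.
  have h := @expR_ge1Dxn R (t^-1) 1 ltac:(by rewrite invr_ge0 ltW).
  rewrite mulrC -ler_pdivrMr ?exprn_gt0// div1r -exprVn.
  have h2 : 1 + t^-1 / 2 <= expR (t^-1 / 2) := expR_ge1Dx _.
  have -> : expR (t^-1) = expR (t^-1 / 2) ^+ 2.
    by rewrite expr2 -expRD -splitr.
  have ti : 0 < t^-1 by rewrite invr_gt0.
  rewrite lerXn2r ?nnegrE ?expR_ge0 ?(ltW ti)//.
  have h3 : expR (t^-1 / 2) = expR (t^-1 / 4) ^+ 2.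
    by rewrite expr2 -expRD; congr expR; field; rewrite gt_eqF.
  have h4 : 1 + t^-1 / 4 <= expR (t^-1 / 4) := expR_ge1Dx _.
  rewrite h3; apply: (@le_trans _ _ ((1 + t^-1 / 4) ^+ 2)); last first.
    by rewrite lerXn2r ?nnegrE ?expR_ge0 ?addr_ge0//; lra.
  have := sqr_ge0 (1 - t^-1 / 4).
  by nra.
wlog ab : a b / a <= b.
  by move=> W; case: (leP a b) => [|/ltW] /W//; rewrite distrC (distrC b).
have dF (t : R) : is_derive t 1 (flat 0) (flat 2 t).
  by have := is_derive_flat 0 t; rewrite mul0r subr0.
have cF : {within `[a, b], continuous (flat 0)}.
  by apply: derivable_within_continuous => x _; have [] := dF x.
have [c _ E] := @MVT_segment R (flat 0) (flat 2) a b ab (fun x _ => dF x) cF.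
rewrite distrC E normrM (distrC a) ger0_norm; last by case/andP: (bd c).
by rewrite ler_piMl//; case/andP: (bd c).
Qed.

Lemma flat0_le1 (t : R) : flat 0 t <= 1.
Proof.
rewrite /flat; case: ifPn => // t0.
by rewrite expr0 invr1 mul1r expR_le1 oppr_le0 invr_ge0 ltW.
Qed.

Lemma flat_gt0 k (t : R) : (0 < flat k t) = (0 < t).
Proof.
rewrite /flat; case: ifPn => [t0|_]; last by rewrite ltxx.
by rewrite mulr_gt0 ?expR_gt0// invr_gt0 exprn_gt0.
Qed.

End flat_functions.

(** * A class of smooth functions closed under partial differentiation *)

Section smooth_closure.
Context {R : realType} {N : nat}.
Implicit Types (f g : 'rV[R]_N -> R) (x : 'rV[R]_N).
Local Notation dir i := (delta_mx ord0 i : 'rV[R]_N).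

(** [smooth] speaks of all iterated partial derivatives, so proving it directly for products or
    quotients would require general Leibniz formulas. This class is instead stable under a single
    partial derivative, and induction on the list of directions yields [smooth]. All orders [k] of
    [flat] occur because differentiation raises [k]. *)
Inductive smooth_expr : ('rV[R]_N -> R) -> Prop :=
| smooth_expr_smooth f : smooth f -> smooth_expr f
| smooth_expr_cst (a : R) : smooth_expr (fun=> a)
| smooth_expr_coord i : smooth_expr (fun x => x ord0 i)
| smooth_exprD f g : smooth_expr f -> smooth_expr g -> smooth_expr (fun x => f x + g x)
| smooth_exprM f g : smooth_expr f -> smooth_expr g -> smooth_expr (fun x => f x * g x)
| smooth_exprV f : smooth_expr f -> (forall x, f x != 0) -> smooth_expr (fun x => (f x)^-1)
| smooth_expr_flat k f : smooth_expr f -> smooth_expr (fun x => flat k (f x)).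

Lemma smooth_exprN f : smooth_expr f -> smooth_expr (fun x => - f x).
Proof.
move=> sf; have := smooth_exprM (smooth_expr_cst (-1)) sf.
by under eq_fun do rewrite mulN1r.
Qed.

Lemma smooth_expr_sum (F : 'I_N -> 'rV[R]_N -> R) :
  (forall i, smooth_expr (F i)) -> smooth_expr (fun x => \sum_(i < N) F i x).
Proof.
move=> sF; elim: (index_enum _) => [|i s IH].
  by under eq_fun do rewrite big_nil; exact: smooth_expr_cst.
by under eq_fun do rewrite big_cons; exact: smooth_exprD.
Qed.

Lemma smooth_partial i f : smooth f -> smooth (partial i f).
Proof. by move=> sf l; have := sf (rcons l i); rewrite foldr_rcons. Qed.

Lemma is_derive_coord (i j : 'I_N) x :
  is_derive x (dir i) (fun y : 'rV[R]_N => y ord0 j : R) ((i == j)%:R).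
Proof.
have [_ /esym E] := @is_derive_id R 'rV[R]_N x (dir i).
have did : derivable (@idfun 'rV[R]_N) x (dir i) by exact: derivable_id.
apply: DeriveDef; first by move/derivable_mxP : did => /(_ ord0 j).
have := congr1 (fun M : 'rV[R]_N => M ord0 j) (derive_mx did).
by rewrite -E !mxE eqxx eq_sym.
Qed.

Lemma continuous_flat k : continuous (@flat R k).
Proof.
move=> t; apply: differentiable_continuous; apply/derivable1_diffP.
by have [] := is_derive_flat k t.
Qed.

Lemma smooth_expr_partial f : smooth_expr f -> continuous f /\ forall i,
  (forall x, derivable f x (dir i)) /\ smooth_expr (partial i f).
Proof.
(* Each constructor then only has to exhibit its partial derivatives by a formula that stays in the
   class. *)
have build h (df : 'I_N -> 'rV[R]_N -> R) : continuous h ->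
    (forall i x, is_derive x (dir i) h (df i x)) ->
    (forall i, smooth_expr (df i)) ->
    continuous h /\ forall i,
      (forall x, derivable h x (dir i)) /\ smooth_expr (partial i h).
  move=> ch dh sh; split => // i; split; first by move=> x; have [] := dh i x.
  suff -> : partial i h = df i by [].
  by apply/funext => x; have [_ <-] := dh i x.
elim=> {f} [f sf|a|j|f g sf [cf df] sg [cg dg]|f g sf [cf df] sg [cg dg]|f sf [cf df] f0|k f sf [cf df]].
- have [cf df] := sf [::]; split => // i; split; first by move=> x; exact: df.
  by apply: smooth_expr_smooth; exact: smooth_partial.
- apply: (build _ (fun _ _ => 0)).
  + exact: cst_continuous.
  + by move=> i; exact: smooth_expr_cst.
- apply: (build _ (fun i _ => (i == j)%:R)).
  + exact: coord_continuous.
  + by move=> i x; exact: is_derive_coord.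
  + by move=> i; exact: smooth_expr_cst.
- apply: (build _ (fun i x => partial i f x + partial i g x)).
  + by move=> x; exact: (continuousD (cf x) (cg x)).
  + move=> i x; apply: (@is_deriveD _ _ _ f g).
      by apply: derivableP; apply: (df i).1.
    by apply: derivableP; apply: (dg i).1.
  + by move=> i; apply: smooth_exprD; [exact: (df i).2|exact: (dg i).2].
- apply: (build _ (fun i x => f x * partial i g x + g x * partial i f x)).
  + by move=> x; exact: (continuousM (cf x) (cg x)).
  + move=> i x; apply: (@is_deriveM _ _ f g).
      by apply: derivableP; apply: (df i).1.
    by apply: derivableP; apply: (dg i).1.
  + by move=> i; apply: smooth_exprD; apply: smooth_exprM => //;
      [exact: (dg i).2|exact: (df i).2].
- apply: (build _ (fun i x => - ((f x)^-1 * (f x)^-1 * partial i f x))).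
  + by move=> x; exact: (continuousV (f0 x) (cf x)).
  + move=> i x; have dfx := (df i).1 x; apply: DeriveDef; first exact: (@derivableV _ _ f x _ (f0 x)).
    by rewrite (@deriveV _ _ f x _ (f0 x))// -[LHS]/(- (f x) ^- 2 * partial i f x) expr2 invfM mulNr.
  + move=> i; apply: smooth_exprN; apply: smooth_exprM; last exact: (df i).2.
    by apply: smooth_exprM; exact: smooth_exprV.
- apply: (build _ (fun i x => (flat k.+2 (f x) - k%:R * flat k.+1 (f x)) * partial i f x)).
  + move=> x; apply: (@continuous_comp _ _ _ f (flat k)); first exact: cf.
    exact: continuous_flat.
  + move=> i x; apply: (@is_derive_comp_dir _ _ (flat k) f).
      exact: is_derive_flat.
    by apply: derivableP; apply: (df i).1.
  + move=> i; apply: smooth_exprM; last exact: (df i).2.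
    apply: smooth_exprD; first exact: smooth_expr_flat.
    apply: smooth_exprN; apply: smooth_exprM; first exact: smooth_expr_cst.
    exact: smooth_expr_flat.
Qed.

Lemma smooth_exprP f : smooth_expr f -> smooth f.
Proof.
move=> sf l; have : smooth_expr (foldr partial f l).
  by elim: l => //= i l IH; have [_ /(_ i)[]] := smooth_expr_partial IH.
by move=> /smooth_expr_partial[c d]; split => // i x; have [] := d i.
Qed.

End smooth_closure.

Section bump.
Context {R : realType} {N : nat}.
Implicit Types (f g : 'rV[R]_N -> R) (x y c : 'rV[R]_N).

(** The factor 2 absorbs the closure: a point of the closed support is within [r] of a point of
    [ball c r]. Compactness is then boundedness and closedness in finite dimension. *)
Lemma test_function_ball (Omega : set 'rV[R]_N) c (r : R) f : 0 < r ->
  smooth_expr f -> (forall x, f x != 0 -> ball c r x) -> ball c (2 * r) `<=` Omega ->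
  test_function Omega f.
Proof.
move=> r0 sf fr cO.
have clc : closure [set x | f x != 0] `<=` ball c (2 * r).
  move=> x /(_ _ (nbhsx_ballx x _ r0))[y [/= /fr cy xy]].
  by rewrite mulr_natl mulr2n; exact: ball_triangle cy (ball_sym xy).
split; first exact: smooth_exprP; last exact: subset_trans cO.
apply: bounded_closed_compact; last exact: closed_closure.
exists (`|c| + 2 * r); split; first exact: num_real.
move=> M hM x /clc; rewrite -ball_normE /= => h.
have := ler_normB c (c - x); rewrite opprB addrC subrK => h2.
by rewrite (le_trans h2)// ltW// (lt_trans _ hM)// ltrD2l.
Qed.

(** The squared Euclidean distance is used because the sup norm is not smooth; [a] is the squared
    radius of the Euclidean ball where the bump is positive. *)
Definition bump c (a : R) x : R := flat 0 (a - \sum_(i < N) (x ord0 i - c ord0 i) ^+ 2).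

Lemma smooth_expr_bump c a : smooth_expr (bump c a).
Proof.
apply: smooth_expr_flat; apply: smooth_exprD; first exact: smooth_expr_cst.
apply: smooth_exprN; apply: smooth_expr_sum => i.
under eq_fun do rewrite expr2.
by apply: smooth_exprM; (apply: smooth_exprD; [exact: smooth_expr_coord|exact: smooth_expr_cst]).
Qed.

Lemma bump_ge0 c a x : 0 <= bump c a x. Proof. exact: flat_ge0. Qed.

Lemma bump_le1 c a x : bump c a x <= 1. Proof. exact: flat0_le1. Qed.

Lemma bump_neq0_coord c a x i : bump c a x != 0 -> (x ord0 i - c ord0 i) ^+ 2 < a.
Proof.
rewrite neq_lt ltNge bump_ge0/= flat_gt0 subr_gt0 => h.
apply: le_lt_trans h; rewrite (bigD1 i)//= lerDl.
by apply: sumr_ge0 => j _; exact: sqr_ge0.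
Qed.

(** The choice [a = N r^2] gives a Euclidean ball of radius [sqrt N * r], which contains the
    sup-norm ball of radius [r] and lies in that of radius [N r]; [N] replaces [sqrt N] for
    convenience. *)
Lemma bump_neq0_ball c r x : 0 < r -> (0 < N)%N ->
  bump c (N%:R * r ^+ 2) x != 0 -> ball c (N%:R * r) x.
Proof.
move=> r0 N0 h; apply/ball_rVP; split=> [|i]; first by rewrite mulr_gt0// ltr0n.
have := bump_neq0_coord i h => h1.
have Nr : 0 <= N%:R * r by rewrite mulr_ge0// ltW.
rewrite -(ltr_pXn2r (n := 2))// ?nnegrE// distrC -normrX ger0_norm ?sqr_ge0//.
apply: lt_le_trans h1 _; rewrite exprMn ler_wpM2r ?sqr_ge0//.
by rewrite -natrX ler_nat leq_pmulr.
Qed.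

Lemma ball_bump_gt0 c r x : (0 < N)%N -> ball c r x -> 0 < bump c (N%:R * r ^+ 2) x.
Proof.
move=> N0 /ball_rVP[r0 h]; rewrite flat_gt0 subr_gt0.
have -> : N%:R * r ^+ 2 = \sum_(i < N) r ^+ 2.
  by rewrite sumr_const card_ord mulr_natl.
apply: ltr_sum.
  by apply/hasP; exists (Ordinal N0); rewrite ?mem_index_enum.
move=> i _; rewrite -(real_normK (num_real (_ - _))) ltr_pXn2r ?nnegrE// ?(ltW r0)//.
by rewrite distrC; exact: h.
Qed.

Lemma measurable_bump c a : measurable_fun setT (bump c a).
Proof. exact: continuous_rV_measurable (smooth_expr_partial (smooth_expr_bump c a)).1. Qed.

End bump.

(** * Finite Gagliardo seminorm of bumps *)

Section geometric_cover.
Context d (T : measurableType d) (R : realType) (m : {measure set T -> \bar R}).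

Lemma nneseries_geometric_lty (C q : R) : 0 <= q < 1 ->
  (\sum_(k <oo) (C * q ^+ k)%:E < +oo)%E.
Proof.
move=> /andP[q0 q1].
have c : series (geometric C q) @ \oo --> C * (1 - q)^-1.
  by apply: cvg_geometric_series; rewrite ger0_norm.
rewrite (_ : \sum_(k <oo) _ = (C * (1 - q)^-1)%:E)%E ?ltry//.
apply/cvg_lim => //.
rewrite (_ : (fun n => _) = EFin \o series (geometric C q)).
  by apply: cvg_EFin => //; exact: nearW.
apply/funext => n; rewrite /= /series/= sumEFin; congr EFin.
Qed.

(** The function is dominated by the sum of [c k] times the indicator of [A k], whose integral is
    bounded by a geometric series. The sets [A k] will be dyadic shells around the diagonal. *)
Lemma integral_geometric_cover_lty (f : T -> R) (A : (set T)^nat) (c : R^nat)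
    (C q : R) : 0 <= q < 1 -> measurable_fun setT f -> (forall z, 0 <= f z) ->
  (forall k, measurable (A k)) -> (forall k, 0 <= c k) ->
  (forall z, f z != 0 -> exists2 k, A k z & f z <= c k) ->
  (forall k, (c k)%:E * m (A k) <= (C * q ^+ k)%:E)%E ->
  (\int[m]_z (f z)%:E < +oo)%E.
Proof.
move=> q01 mf f0 mA c0 fA cA.
pose g k z := ((c k)%:E * (\1_(A k) z)%:E)%E.
have mg k : measurable_fun setT (g k).
  by apply: measurable_funeM; apply/measurable_EFinP; exact: measurable_indic.
have g0 k z : (0 <= g k z)%E by rewrite mule_ge0 ?lee_fin.
apply: (@le_lt_trans _ _ (\int[m]_z (\sum_(k <oo) g k z))%E).
  apply: ge0_le_integral => //.
  - by move=> z _; rewrite lee_fin.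
  - exact/measurable_EFinP.
  - by apply: ge0_emeasurable_sum => // k _ z _ _; exact: g0.
  move=> z _; have [->|/fA[k Ak fc]] := eqVneq (f z) 0.
    by apply: nneseries_ge0 => k _ _; exact: g0.
  apply: (@le_trans _ _ (\sum_(0 <= i < k.+1) g i z)%E); last first.
    by apply: nneseries_lim_ge => i _ _; exact: g0.
  rewrite big_nat_recr//= -[leLHS]add0e leeD//; first exact: sume_ge0.
  by rewrite /g indicE mem_set// mule1 lee_fin.
rewrite integral_nneseries//.
apply: le_lt_trans (nneseries_geometric_lty C q01).
apply: lee_nneseries => k _; first by rewrite integral_ge0.
rewrite ge0_integralZl//; last 2 first.
- by apply/measurable_EFinP; exact: measurable_indic.
- by rewrite lee_fin.
by rewrite integral_indic// setIT.
Qed.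
End geometric_cover.

(** * Measures of boxes and of strips along the diagonal *)

Section boxes.
Context {R : realType} {N : nat}.
Local Notation mu := (@lebesgue_rV R N).
Implicit Types x y c : 'rV[R]_N.

Definition box c (a : R) : set 'rV[R]_N := [set x : 'rV[R]_N | forall i, `|x ord0 i - c ord0 i| <= a].

Lemma measurable_box c a : measurable (box c a).
Proof.
rewrite (_ : box c a = \bigcap_(i in [set: 'I_N]) ((fun x : 'rV[R]_N => x ord0 i) @^-1`
    [set t : R | `|t - c ord0 i| <= a])); last first.
  by apply/seteqP; split=> x /= h; [move=> i _|move=> i]; exact: h.
apply: fin_bigcap_measurable => // i _.
rewrite -[X in measurable X]setTI; apply: measurable_coord => //.
have -> : [set t : R | `|t - c ord0 i| <= a] = [set` `[c ord0 i - a, c ord0 i + a]].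
  by apply/seteqP; split => t /=; rewrite in_itv/= ler_distl.
exact: measurable_itv.
Qed.

Lemma lebesgue_box c a : 0 <= a -> mu (box c a) = ((2 * a) ^+ N)%:E.
Proof.
move=> a0.
have -> : box c a = [set x : 'rV[R]_N | forall i,
    x ord0 i \in `[(c - const_mx a) ord0 i, (c + const_mx a) ord0 i]].
  by apply/seteqP; split => x /= h i; have := h i; rewrite !mxE in_itv/= ler_distl.
rewrite lebesgue_rV_box; last by move=> i; rewrite !mxE; lra.
congr EFin; rewrite -[in RHS](card_ord N) -prodr_const; apply: eq_bigr => i _.
by rewrite !mxE; ring.
Qed.

Definition diag_strip c (a b : R) : set ('rV[R]_N * 'rV[R]_N) :=
  [set z : 'rV[R]_N * 'rV[R]_N | box c a z.1 /\ forall i, `|z.2 ord0 i - z.1 ord0 i| <= b].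

Lemma measurable_coord1 (i : 'I_N) : measurable_fun setT (fun z : 'rV[R]_N * 'rV[R]_N => z.1 ord0 i).
Proof. exact: (measurableT_comp (measurable_coord i) measurable_fst). Qed.

Lemma measurable_coord2 (i : 'I_N) : measurable_fun setT (fun z : 'rV[R]_N * 'rV[R]_N => z.2 ord0 i).
Proof. exact: (measurableT_comp (measurable_coord i) measurable_snd). Qed.

Lemma measurable_diag_strip c a b : measurable (diag_strip c a b).
Proof.
rewrite (_ : diag_strip c a b = (fst @^-1` box c a) `&`
    \bigcap_(i in [set: 'I_N]) ((fun z : 'rV[R]_N * 'rV[R]_N => `|z.2 ord0 i - z.1 ord0 i|) @^-1`
    [set` `]-oo, b]])).
  apply: measurableI.
    rewrite -[X in measurable X]setTI; apply: measurable_fst => //.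
    exact: measurable_box.
  apply: fin_bigcap_measurable => // i _.
  rewrite -[X in measurable X]setTI; apply: measurableT_comp => //.
  by apply: measurable_funB; [exact: measurable_coord2|exact: measurable_coord1].
apply/seteqP; split=> z /= [h1 h2]; split => // i; last by have := h2 i I; rewrite /= in_itv.
by move=> _; rewrite /= in_itv; exact: h2.
Qed.

(** By Fubini: the section over a point [x] of [box c a] is [box x b], and the other sections are
    empty. *)
Lemma lebesgue_diag_strip c a b : 0 <= a -> 0 <= b ->
  (mu \x mu)%E (diag_strip c a b) = ((2 * b) ^+ N * (2 * a) ^+ N)%:E.
Proof.
move=> a0 b0; rewrite /product_measure1.
rewrite (eq_integral (fun x => (((2 * b) ^+ N)%:E * (\1_(box c a) x)%:E)%E)); last first.
  move=> x _ /=; rewrite indicE; have [xa|xa] := boolP (x \in box c a).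
    rewrite mule1 -(lebesgue_box x b0); congr (mu _).
    apply/seteqP; split => y; rewrite /xsection /= inE; first by case.
    by move=> h; split => //; exact: set_mem xa.
  rewrite mule0 (_ : xsection _ _ = set0) ?measure0//.
  apply/seteqP; split => y //; rewrite /xsection /= inE => -[/= xa' _].
  by rewrite (mem_set xa') in xa.
rewrite ge0_integralZl//; last 2 first.
- by apply/measurable_EFinP; apply: measurable_indic; exact: measurable_box.
- by rewrite lee_fin exprn_ge0// mulr_ge0.
rewrite integral_indic ?setIT//; last exact: measurable_box.
by rewrite EFinM; congr (_ * _)%E; exact: lebesgue_box.
Qed.

Lemma measurable_enorm_dist :
  measurable_fun setT (fun z : 'rV[R]_N * 'rV[R]_N => enorm (z.1 - z.2)).
Proof.
rewrite /enorm; apply: measurableT_comp.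
  by apply: continuous_measurable_fun; exact: sqrt_continuous.
apply: measurable_sum => i; apply: measurable_funX.
under eq_fun do rewrite !mxE.
by apply: measurable_funB; [exact: measurable_coord1|exact: measurable_coord2].
Qed.

Lemma coord_le_enorm x (i : 'I_N) : `|x ord0 i| <= enorm x.
Proof.
rewrite -sqrtr_sqr ler_sqrt ?sqr_ge0//.
  by rewrite (bigD1 i)//= lerDl; apply: sumr_ge0 => j _; exact: sqr_ge0.
by apply: sumr_ge0 => j _; exact: sqr_ge0.
Qed.

Lemma enorm_ge0 x : 0 <= enorm x. Proof. exact: sqrtr_ge0. Qed.

End boxes.

Section bump_gagliardo.
Context {R : realType} {N : nat}.
Local Notation mu := (@lebesgue_rV R N).
Implicit Types x y c : 'rV[R]_N.

Lemma dyadic_le1 (h : R) : 0 < h <= 1 -> exists k, 2^-1 ^+ k.+1 < h <= 2^-1 ^+ k.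
Proof.
move=> /andP[h0 h1].
have ex : exists k, 2^-1 ^+ k.+1 < h.
  have [k _ /(_ k (leqnn k)) hk] := @near_infty_natSinv_lt R (PosNum h0).
  exists k; apply: le_lt_trans hk => /=.
  rewrite exprVn lef_pV2 ?posrE ?exprn_gt0//.
  by rewrite -natrX ler_nat ltnW// ltn_expl.
have := ex_minnP ex => -[k hk kmin]; exists k; rewrite hk/=.
case: k {hk} kmin => [|k] kmin; first by rewrite expr0.
by rewrite leNgt; apply/negP => /kmin; rewrite ltnn.
Qed.

Lemma powR_exprn (t e : R) k : 0 <= t -> (t ^+ k) `^ e = (t `^ e) ^+ k.
Proof.
by move=> t0; rewrite -(powR_mulrn k t0) -(powR_mulrn k (powR_ge0 _ _)) powRAC.
Qed.

Lemma powR_half_bound (e : R) : 0 < e -> 0 <= (2^-1 : R) `^ e < 1.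
Proof.
move=> e0; rewrite powR_ge0/=.
have h : (2^-1 : R) `^ e < 1 `^ e.
  apply: gt0_ltr_powR; rewrite ?nnegrE ?invr_ge0//.
  by rewrite invf_lt1// ltr1n.
by move: h; rewrite powR1.
Qed.

Lemma lebesgue_boxX c (a b : R) : 0 <= a -> 0 <= b ->
  (mu \x mu)%E (box c a `*` box c b) = ((2 * a) ^+ N * (2 * b) ^+ N)%:E.
Proof.
move=> a0 b0; rewrite product_measure1E; [|exact: measurable_box..].
by rewrite EFinM; congr (_ * _)%E; exact: lebesgue_box.
Qed.

(** [flat 0] is 1-Lipschitz, and in each coordinate the difference of squares factors through
    [x - y]. The point [y] may be anywhere: the other factor is [2 (x - c) - (x - y)], and
    [|x - c| <= r] holds coordinatewise on the support. *)
Lemma bump_lip c a x y (r : R) : a <= r ^+ 2 -> 0 <= r -> bump c a x != 0 ->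
  `|bump c a x - bump c a y| <= N%:R * (2 * r + enorm (x - y)) * enorm (x - y).
Proof.
move=> ar r0 hx; apply: le_trans (flat_lipschitz0 _ _) _.
set Sx := \sum_(i < N) _; set Sy := \sum_(i < N) _.
have -> : a - Sx - (a - Sy) = Sy - Sx by ring.
rewrite -sumrB -mulrA mulr_natl -[X in _ *+ X](card_ord N) -sumr_const.
apply: le_trans (ler_norm_sum _ _ _) _; apply: ler_sum => i _.
have hi := bump_neq0_coord i hx.
have hi' : `|x ord0 i - c ord0 i| <= r.
  rewrite -(ler_pXn2r (n := 2))// ?nnegrE// real_normK ?num_real//.
  exact: le_trans (ltW hi) ar.
have hxy : `|x ord0 i - y ord0 i| <= enorm (x - y).
  by have := coord_le_enorm (x - y) i; rewrite !mxE.
have -> : (y ord0 i - c ord0 i) ^+ 2 - (x ord0 i - c ord0 i) ^+ 2 =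
    (2 * (x ord0 i - c ord0 i) - (x ord0 i - y ord0 i)) * - (x ord0 i - y ord0 i).
  by ring.
rewrite normrM normrN; apply: ler_pM => //.
apply: le_trans (ler_normB _ _) _; rewrite lerD// normrM ger0_norm//.
by rewrite ler_pM2l.
Qed.

Lemma bump_neq0_box c a x (r : R) : 0 <= r -> a <= r ^+ 2 -> bump c a x != 0 -> box c r x.
Proof.
move=> r0 ar hx i; rewrite -(ler_pXn2r (n := 2))// ?nnegrE// real_normK ?num_real//.
exact: le_trans (ltW (bump_neq0_coord i hx)) ar.
Qed.

Variables s p : R.
Hypotheses (s_gt0 : 0 < s) (s_lt1 : s < 1) (p_gt0 : 0 < p).

Local Notation E := (N%:R + s * p).
Let E_gt0 : 0 < E. Proof. by rewrite ltr_wpDl// mulr_gt0. Qed.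

Definition gagliardo_density (f : 'rV[R]_N -> R) (z : 'rV[R]_N * 'rV[R]_N) : R :=
  `|f z.1 - f z.2| `^ p / enorm (z.1 - z.2) `^ E.

Lemma gagliardo_density_ge0 f z : 0 <= gagliardo_density f z.
Proof. by rewrite divr_ge0// powR_ge0. Qed.

Lemma measurable_comp_fst (f : 'rV[R]_N -> R) : measurable_fun setT f ->
  measurable_fun setT (fun z : 'rV[R]_N * 'rV[R]_N => f z.1).
Proof. by move=> mf; exact: (measurableT_comp mf measurable_fst). Qed.

Lemma measurable_comp_snd (f : 'rV[R]_N -> R) : measurable_fun setT f ->
  measurable_fun setT (fun z : 'rV[R]_N * 'rV[R]_N => f z.2).
Proof. by move=> mf; exact: (measurableT_comp mf measurable_snd). Qed.

Lemma measurable_kernel :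
  measurable_fun setT (fun z : 'rV[R]_N * 'rV[R]_N => (enorm (z.1 - z.2) `^ E)^-1).
Proof.
under eq_fun do rewrite -powRN.
exact: (measurableT_comp (measurable_powR _) measurable_enorm_dist).
Qed.

Lemma measurable_gagliardo_density f : measurable_fun setT f ->
  measurable_fun setT (gagliardo_density f).
Proof.
move=> mf; apply: measurable_funM; last exact: measurable_kernel.
apply: (measurableT_comp (measurable_powR _)); apply: measurableT_comp => //.
by apply: measurable_funB; [exact: measurable_comp_fst|exact: measurable_comp_snd].
Qed.

Lemma bump_density_neq0 c a z : gagliardo_density (bump c a) z != 0 ->
  0 < enorm (z.1 - z.2) /\ (bump c a z.1 != 0 \/ bump c a z.2 != 0).
Proof.
move=> h; split.
  rewrite lt_neqAle enorm_ge0 andbT eq_sym; apply: contra_neq h => e0.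
  by rewrite /gagliardo_density e0 powR0 ?gt_eqF// invr0 mulr0.
apply/orP; rewrite -negb_and; apply: contra h => /andP[/eqP e1 /eqP e2].
by rewrite /gagliardo_density e1 e2 subrr normr0 powR0 ?mul0r// gt_eqF.
Qed.

Let D := [set z : 'rV[R]_N * 'rV[R]_N | enorm (z.1 - z.2) <= 1].

Let mD : measurable D.
Proof.
rewrite (_ : D = (fun z : 'rV[R]_N * 'rV[R]_N => enorm (z.1 - z.2)) @^-1` [set` `]-oo, 1]]).
  by rewrite -[X in measurable X]setTI; apply: measurable_enorm_dist.
by apply/seteqP; split => z; rewrite /D /= in_itv.
Qed.

(** On the shell where [|x - y|] is about [t = 2^-k], the Lipschitz bound makes the density of order
    [t^(p - N - s p)] and the strip has measure of order [t^N]. The contributions decay like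
    [t^(p - s p)], which is summable since [s < 1]. *)
Lemma bump_gagliardo_near c a : 0 <= a ->
  (\int[mu \x mu]_z (gagliardo_density (bump c a) z * \1_D z)%:E < +oo)%E.
Proof.
(* Any [r] with [r^2 >= a] bounds the support radius; [a + 1] avoids a square root. *)
move=> a0; pose r := a + 1.
have r0 : 0 <= r by rewrite /r; lra.
have ar : a <= r ^+ 2 by rewrite /r; nra.
pose L := N%:R * (2 * r + 1).
have L0 : 0 <= L by rewrite mulr_ge0//; lra.
pose t k : R := 2^-1 ^+ k.
have t0 k : 0 < t k by rewrite exprn_gt0// invr_gt0.
have t1 k : t k <= 1 by rewrite exprn_ile1// ?invr_ge0// invf_le1// ler1n.
(* If only the second point is in the support, the first is within distance 1 of it, hence the box
   of radius [r + 1]. The shell is [t k / 2 < |x - y| <= t k], hence [t k / 2] in the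
   denominator. *)
apply: (@integral_geometric_cover_lty _ _ _ _ _ (fun k => diag_strip c (r + 1) (t k))
  (fun k => (L * t k) `^ p / (t k / 2) `^ E)
  (L `^ p * 2 `^ E * (2 ^+ N * (2 * (r + 1)) ^+ N)) (2^-1 `^ (p - s * p))).
- by apply: powR_half_bound; rewrite -{1}(mul1r p) -mulrBl mulr_gt0 ?subr_gt0.
- apply: measurable_funM; last exact: measurable_indic.
  by apply: measurable_gagliardo_density; exact: measurable_bump.
- by move=> z; rewrite mulr_ge0 ?gagliardo_density_ge0.
- by move=> k; exact: measurable_diag_strip.
- by move=> k; rewrite divr_ge0// powR_ge0.
- move=> z; rewrite indicE; case: (boolP (z \in D)) => [/set_mem zD|_]; last by rewrite mulr0 eqxx.
  rewrite mulr1 => /bump_density_neq0[h0 hz].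
  have [k /andP[k1 k2]] := @dyadic_le1 (enorm (z.1 - z.2)) ltac:(by rewrite h0).
  have zi i : `|z.2 ord0 i - z.1 ord0 i| <= enorm (z.1 - z.2).
    by rewrite distrC; have := coord_le_enorm (z.1 - z.2) i; rewrite !mxE.
  exists k.
    split => [i|i]; last exact: le_trans (zi i) k2.
    case: hz => [/(bump_neq0_box r0 ar)/(_ i) h|/(bump_neq0_box r0 ar)/(_ i) h].
      by apply: le_trans h _; rewrite lerDl.
    have := le_trans (zi i) zD; move: h.
    by rewrite !ler_norml => /andP[? ?] /andP[? ?]; apply/andP; split; lra.
  have lip : `|bump c a z.1 - bump c a z.2| <=
      N%:R * (2 * r + enorm (z.1 - z.2)) * enorm (z.1 - z.2).
    case: hz => hz; first exact: bump_lip.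
    rewrite distrC (_ : enorm (z.1 - z.2) = enorm (z.2 - z.1)); first exact: bump_lip.
    by rewrite /enorm; congr Num.sqrt; apply: eq_bigr => i _; rewrite !mxE; ring.
  apply: ler_pM; rewrite ?powR_ge0 ?invr_ge0 ?powR_ge0//.
    apply: ge0_ler_powR; rewrite ?nnegrE// ?mulr_ge0 ?(ltW p_gt0) ?(ltW (t0 k))//.
      by lra.
    apply: le_trans lip _; apply: ler_pM => //; rewrite ?mulr_ge0 ?addr_ge0 ?enorm_ge0//.
      by rewrite mulr_ge0.
    by rewrite ler_wpM2l// lerD2l.
  rewrite lef_pV2 ?posrE ?powR_gt0// ?divr_gt0//.
  apply: ge0_ler_powR; rewrite ?nnegrE ?(ltW E_gt0) ?divr_ge0 ?(ltW (t0 k)) ?(ltW h0)//.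
  by apply: le_trans (ltW k1); rewrite /t exprSr.
- move=> k; rewrite [X in (_ * X <= _)%E](lebesgue_diag_strip c (addr_ge0 r0 ler01) (ltW (t0 k))) -EFinM lee_fin.
  rewrite -powR_exprn ?invr_ge0// -/(t k).
  have tn0 : t k != 0 by rewrite gt_eqF.
  have key : t k `^ (p - s * p) = t k `^ p * (t k `^ E)^-1 * t k ^+ N.
    rewrite powRB ?tn0 ?implybT// [t k `^ E]powRD ?tn0 ?implybT// powR_mulrn ?(ltW (t0 k))//.
    have := expf_neq0 N tn0; have : t k `^ (s * p) != 0 by rewrite gt_eqF ?powR_gt0.
    by move: (t k ^+ N) (t k `^ (s * p)) => X v v0 X0; field; apply/andP.
  have e2 : (t k / 2) `^ E = (2 `^ E)^-1 * t k `^ E.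
    rewrite powRM ?invr_ge0 ?(ltW (t0 k))// mulrC; congr (_ * _).
    by rewrite -(powR_inv1 (ler0n R 2)) -powRrM mulN1r powRN.
  rewrite key e2 (powRM p L0 (ltW (t0 k))) invfM invrK (exprMn _ 2 (t k)).
  by rewrite le_eqVlt; apply/orP; left; apply/eqP; ring.
Qed.

(** Here [|x - y|] is about [1/t] with [t = 2^-k]. The numerator is at most 1, the kernel at most
    [t^(N + s p)], and the region has measure of order [t^-N], leaving [t^(s p)], summable since
    [s p > 0]. *)
Lemma bump_gagliardo_far c a : 0 <= a ->
  (\int[mu \x mu]_z (gagliardo_density (bump c a) z * \1_(~` D) z)%:E < +oo)%E.
Proof.
move=> a0; pose r := a + 1.
have r0 : 0 <= r by rewrite /r; lra.
have ar : a <= r ^+ 2 by rewrite /r; nra.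
pose t k : R := 2^-1 ^+ k.
have t0 k : 0 < t k by rewrite exprn_gt0// invr_gt0.
have t1 k : t k <= 1 by rewrite exprn_ile1// ?invr_ge0// invf_le1// ler1n.
pose b k := r + 2 / t k.
have b0 k : 0 <= b k by rewrite addr_ge0// divr_ge0// ltW.
(* One of the two points lies in the support, and the other within [2 / t k] of it; the union covers
   both cases. *)
pose A k := (box c r `*` box c (b k)) `|` (box c (b k) `*` box c r).
have mA1 k : measurable (box c r `*` box c (b k)).
  by apply: measurableX; exact: measurable_box.
have mA2 k : measurable (box c (b k) `*` box c r).
  by apply: measurableX; exact: measurable_box.
apply: (@integral_geometric_cover_lty _ _ _ _ _ A (fun k => t k `^ E)
  (2 * (2 * r) ^+ N * (2 * (r + 2)) ^+ N) (2^-1 `^ (s * p))).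
- by apply: powR_half_bound; exact: mulr_gt0.
- apply: measurable_funM; last by apply: measurable_indic; exact: measurableC.
  by apply: measurable_gagliardo_density; exact: measurable_bump.
- by move=> z; rewrite mulr_ge0 ?gagliardo_density_ge0.
- by move=> k; exact: measurableU.
- by move=> k; rewrite powR_ge0.
- move=> z; rewrite indicE; case: (boolP (z \in ~` D)) => [/set_mem/negP|_]; last by rewrite mulr0 eqxx.
  rewrite -ltNge => zD.
  rewrite mulr1 => /bump_density_neq0[h0 hz].
  have [k /andP[k1 k2]] := @dyadic_le1 (enorm (z.1 - z.2))^-1 ltac:(by rewrite invr_gt0 h0 invf_le1// ltW).
  have zi i : `|z.2 ord0 i - z.1 ord0 i| <= 2 / t k.
    rewrite distrC; have := coord_le_enorm (z.1 - z.2) i; rewrite !mxE => /le_trans; apply.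
    rewrite -[leLHS]invrK -[leRHS]invrK lef_pV2 ?posrE ?invr_gt0 ?divr_gt0//.
    by rewrite invfM invrK mulrC; apply: le_trans (ltW k1); rewrite /t exprSr.
  exists k.
    case: hz => [/(bump_neq0_box r0 ar) h|/(bump_neq0_box r0 ar) h]; [left|right]; split => // i.
      have := zi i; move: (h i).
      by rewrite !ler_norml /b => /andP[? ?] /andP[? ?]; apply/andP; split; lra.
    have := zi i; move: (h i).
    by rewrite !ler_norml /b => /andP[? ?] /andP[? ?]; apply/andP; split; lra.
  rewrite /gagliardo_density -[leRHS]mul1r; apply: ler_pM; rewrite ?powR_ge0 ?invr_ge0 ?powR_ge0//.
    have -> : 1 = 1 `^ p :> R by rewrite powR1.
    apply: ge0_ler_powR; rewrite ?nnegrE ?(ltW p_gt0)//.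
    have := bump_ge0 c a z.1; have := bump_ge0 c a z.2.
    have := bump_le1 c a z.1; have := bump_le1 c a z.2.
    by rewrite ler_norml => ? ? ? ?; apply/andP; split; lra.
  rewrite -powRN -[X in _ `^ X]mulN1r powRrM powR_inv1 ?(ltW h0)//.
  by apply: ge0_ler_powR => //; rewrite ?nnegrE ?invr_ge0 ltW.
- move=> k.
  have hA : ((mu \x mu)%E (A k) <= (2 * ((2 * r) ^+ N * (2 * b k) ^+ N))%:E)%E.
    apply: le_trans (measureU2 _ (mA1 k) (mA2 k)) _ => /=.
    rewrite [X in (X + _)%E](lebesgue_boxX c r0 (b0 k)) [X in (_ + X)%E](lebesgue_boxX c (b0 k) r0).
    rewrite -EFinD lee_fin; set u := _ ^+ N; set v := _ ^+ N.
    by rewrite le_eqVlt; apply/orP; left; apply/eqP; ring.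
  apply: le_trans (lee_wpmul2l _ hA) _; first by rewrite lee_fin powR_ge0.
  rewrite -EFinM lee_fin -powR_exprn ?invr_ge0// -/(t k).
  have hb : b k <= (r + 2) / t k.
    by rewrite /b [leRHS]mulrDl lerD2r// ler_pdivlMr// ler_piMr.
  have hbN : (2 * b k) ^+ N <= (2 * (r + 2)) ^+ N * t k ^- N.
    rewrite -exprVn -exprMn -mulrA.
    by apply: lerXn2r; rewrite ?nnegrE ?mulr_ge0 ?b0 ?addr_ge0 ?invr_ge0 ?(ltW (t0 k))// ler_pM2l.
  rewrite powRD ?(gt_eqF (t0 k)) ?implybT// powR_mulrn ?(ltW (t0 k))//.
  apply: (@le_trans _ _ (t k ^+ N * t k `^ (s * p) * (2 * ((2 * r) ^+ N * ((2 * (r + 2)) ^+ N * t k ^- N))))).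
    rewrite ler_wpM2l ?mulr_ge0 ?exprn_ge0 ?powR_ge0 ?(ltW (t0 k))//.
    by rewrite ler_pM2l// ler_wpM2l// exprn_ge0// mulr_ge0.
  rewrite le_eqVlt; apply/orP; left; apply/eqP; field.
  by rewrite gt_eqF ?exprn_gt0.
Qed.

Lemma bump_gagliardo_lty c a : 0 <= a ->
  (\int[mu \x mu]_z (gagliardo_density (bump c a) z)%:E < +oo)%E.
Proof.
move=> a0.
have mg B : measurable B -> measurable_fun setT (fun z => (gagliardo_density (bump c a) z * \1_B z)%:E).
  move=> mB; apply/measurable_EFinP; apply: measurable_funM; last exact: measurable_indic.
  by apply: measurable_gagliardo_density; exact: measurable_bump.
have g0 B z : (0 <= (gagliardo_density (bump c a) z * \1_B z)%:E)%E.
  by rewrite lee_fin mulr_ge0 ?gagliardo_density_ge0.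
rewrite (eq_integral (fun z => (gagliardo_density (bump c a) z * \1_D z)%:E +
    (gagliardo_density (bump c a) z * \1_(~` D) z)%:E)%E); last first.
  by move=> z _; rewrite -EFinD -mulrDr !indicE in_setC; case: (z \in D); rewrite ?addr0 ?add0r mulr1.
rewrite ge0_integralD//; [|exact: mg|by apply: mg; exact: measurableC].
by apply: lte_add_pinfty; [exact: bump_gagliardo_near|exact: bump_gagliardo_far].
Qed.

End bump_gagliardo.

(** * Cutoffs of the solution *)

Section cutoff.
Context {R : realType}.
Implicit Types j v a b : R.

Definition cutoff j v : R := (1 + (j * v) ^+ 2)^-1.

Lemma cutoff_den_gt0 j v : 0 < 1 + (j * v) ^+ 2.
Proof. by rewrite ltr_pwDl// sqr_ge0. Qed.

Lemma cutoff_gt0 j v : 0 < cutoff j v.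
Proof. by rewrite invr_gt0 cutoff_den_gt0. Qed.

Lemma cutoff_le1 j v : cutoff j v <= 1.
Proof. by rewrite invf_le1 ?cutoff_den_gt0// lerDl sqr_ge0. Qed.

Lemma cutoff0 j : cutoff j 0 = 1.
Proof. by rewrite /cutoff mulr0 expr0n addr0 invr1. Qed.

Lemma cutoff_anti j a b : `|a| <= `|b| -> cutoff j b <= cutoff j a.
Proof.
move=> ab; rewrite lef_pV2 ?posrE ?cutoff_den_gt0// lerD2l !exprMn ler_wpM2l ?sqr_ge0//.
by rewrite -(real_normK (num_real a)) -(real_normK (num_real b)) lerXn2r.
Qed.

Lemma cutoff_anti_scale i j a : 0 <= i <= j -> cutoff j a <= cutoff i a.
Proof.
move=> /andP[i0 ij]; rewrite lef_pV2 ?posrE ?cutoff_den_gt0// lerD2l !exprMn.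
by rewrite ler_wpM2r ?sqr_ge0// lerXn2r// nnegrE// (le_trans i0).
Qed.

Lemma cutoff_lipschitz j a b : `|cutoff j a - cutoff j b| <= `|j| * `|a - b|.
Proof.
have A0 := cutoff_den_gt0 j a; have B0 := cutoff_den_gt0 j b.
have -> : cutoff j a - cutoff j b = (j * (a - b)) *
   (- (j * a + j * b) / ((1 + (j * a) ^+ 2) * (1 + (j * b) ^+ 2))).
  by rewrite /cutoff; field; rewrite !gt_eqF.
rewrite normrM normrM ler_piMr ?mulr_ge0// normrM normrN normfV.
rewrite [X in _ / X]ger0_norm ?mulr_ge0 ?(ltW A0) ?(ltW B0)//.
rewrite ler_pdivrMr ?mulr_gt0// mul1r.
(* What remains is [|x + y| <= (1 + x^2) (1 + y^2)], which follows from [2 |x| <= 1 + x^2] and its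
   analogue for [y]. *)
move: (j * a) (j * b) => x y; rewrite ler_norml; apply/andP.
have := sqr_ge0 (x - 1); have := sqr_ge0 (x + 1); have := sqr_ge0 (y - 1).
have := sqr_ge0 (y + 1); have : 0 <= x ^+ 2 * y ^+ 2 by rewrite mulr_ge0 ?sqr_ge0.
by split; nra.
Qed.

Lemma continuous_cutoff j : continuous (cutoff j).
Proof.
move=> v; have cl : {for v, continuous (fun v => j * v)}.
  by apply: continuousM; [exact: cst_continuous|exact: cvg_id].
have c : {for v, continuous (fun v => 1 + (j * v) ^+ 2)}.
  by apply: continuousD; [exact: cst_continuous|exact: (continuousM cl cl)].
by apply: (continuousV _ c); rewrite gt_eqF ?cutoff_den_gt0.
Qed.

Lemma cutoff_cvg0 v : v != 0 -> cutoff n%:R v @[n --> \oo] --> 0.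
Proof.
move=> v0; have v2 : 0 < v ^+ 2 by rewrite exprn_even_gt0.
(* The majorant [2 / (v^2 (n + 1))] is valid for [n >= 1], because
   [2 n^2 - n - 1 = (2 n + 1) (n - 1)]. *)
apply: (@squeeze_cvgr _ _ _ _ (cst 0) (fun n => (v ^+ 2)^-1 * harmonic n * 2)).
- near=> n; rewrite ltW ?cutoff_gt0//=.
  have d0 : 0 < v ^+ 2 * n.+1%:R by rewrite mulr_gt0.
  have d1 := cutoff_den_gt0 n%:R v.
  rewrite /harmonic /= -ler_pdivrMr// -!invfM lef_pV2 ?posrE ?d0 ?(mulr_gt0 d1)//.
  rewrite exprMn.
  have n1 : 1 <= n%:R :> R by rewrite ler1n; near: n; exact: nbhs_infty_ge.
  rewrite -natr1; move: (v ^+ 2) (n%:R) v2 n1 => x y x0 y1.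
  have : 0 <= x * ((2 * y + 1) * (y - 1)) by rewrite !mulr_ge0 ?(ltW x0)//; lra.
  by nra.
- exact: cvg_cst.
- have h1 : (v ^+ 2)^-1 * harmonic n @[n --> \oo] --> (v ^+ 2)^-1 * 0.
    by apply: cvgMl_tmp; exact: cvg_harmonic.
  have h2 : (v ^+ 2)^-1 * harmonic n * 2 @[n --> \oo] --> (v ^+ 2)^-1 * 0 * 2.
    exact: cvgMr_tmp h1.
  by move: h2; rewrite mulr0 mul0r.
Unshelve. all: by end_near. Qed.

Lemma cutoff_diff_le (e1 e2 a b j : R) : 0 <= e1 <= 1 -> 0 <= e2 <= 1 ->
  `|e1 * cutoff j a - e2 * cutoff j b| <= `|e1 - e2| + `|j| * `|a - b|.
Proof.
move=> /andP[e10 e11] /andP[e20 e21].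
have -> : e1 * cutoff j a - e2 * cutoff j b =
  (e1 - e2) * cutoff j a + e2 * (cutoff j a - cutoff j b) by ring.
apply: le_trans (ler_normD _ _) _; apply: lerD; rewrite normrM.
  by rewrite ler_piMr// ger0_norm ?cutoff_le1// ltW// cutoff_gt0.
by apply: le_trans (cutoff_lipschitz _ _ _); rewrite ler_piMl// ger0_norm.
Qed.

Variable p : R.
Hypothesis p_gt1 : 1 < p.

Lemma signed_power0 : signed_power p 0 = 0. Proof. by rewrite /signed_power mulr0. Qed.

Lemma signed_power_gt0 a : 0 < a -> 0 < signed_power p a.
Proof. by move=> a0; rewrite mulr_gt0// powR_gt0// gtr0_norm. Qed.

Lemma signed_power_ge0 a : 0 <= a -> 0 <= signed_power p a.
Proof. by move=> a0; rewrite mulr_ge0// powR_ge0. Qed.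

Lemma signed_powerN a : signed_power p (- a) = - signed_power p a.
Proof. by rewrite /signed_power normrN mulrN. Qed.

Lemma normr_signed_power a : `|signed_power p a| = `|a| `^ (p - 1).
Proof.
rewrite /signed_power normrM [X in X * _]ger0_norm ?powR_ge0//.
have [->|a0] := eqVneq a 0; first by rewrite normr0 mulr0 powR0// subr_eq0 gt_eqF.
rewrite mulrC (_ : p - 2 = p - 1 - 1); last by ring.
by rewrite mulr_powRB1// subr_gt0.
Qed.

(** The left side is [|a|^(p-1) |b|], at most the [p]-th power of the larger of [|a|] and [|b|].
    This crude form of Young's inequality makes every integrand below integrable. *)
Lemma signed_power_young a b : `|signed_power p a| * `|b| <= `|a| `^ p + `|b| `^ p.
Proof.
rewrite normr_signed_power.
have p0 : 0 < p by apply: lt_trans p_gt1.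
have P1 : 0 < p - 1 by rewrite subr_gt0.
have [ab|/ltW ba] := leP `|a| `|b|.
  rewrite ler_wpDl ?powR_ge0// -(mulr_powRB1 (normr_ge0 b) p0) mulrC ler_wpM2l//.
  by apply: ge0_ler_powR; rewrite ?nnegrE ?(ltW P1).
by rewrite ler_wpDr ?powR_ge0// -(mulr_powRB1 (normr_ge0 a) p0) mulrC ler_wpM2r// powR_ge0.
Qed.

End cutoff.

(** * Null sets in the product, and a reference box outside the domain *)

Section almost_everywhere_product.
Context {R : realType} {N : nat}.
Local Notation mu := (@lebesgue_rV R N).

Lemma negligible_fst (A : set 'rV[R]_N) : mu.-negligible A -> (mu \x mu)%E.-negligible (fst @^-1` A).
Proof.
move=> [B [mB B0 AB]]; exists (B `*` setT); split.
- exact: measurableX.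
- have := product_measure1E mu mu mB measurableT.
  by rewrite [X in (X * _)%E]B0 mul0e.
- by move=> z /AB; split.
Qed.

Lemma negligible_snd (A : set 'rV[R]_N) : mu.-negligible A -> (mu \x mu)%E.-negligible (snd @^-1` A).
Proof.
move=> [B [mB B0 AB]]; exists (setT `*` B); split.
- exact: measurableX.
- have := product_measure1E mu mu measurableT mB.
  by rewrite [X in (_ * X)%E]B0 mule0.
- by move=> z /AB; split.
Qed.

Lemma ae_fst (P : 'rV[R]_N -> Prop) : {ae mu, forall x, P x} -> {ae (mu \x mu)%E, forall z, P z.1}.
Proof. exact: negligible_fst. Qed.

Lemma ae_snd (P : 'rV[R]_N -> Prop) : {ae mu, forall x, P x} -> {ae (mu \x mu)%E, forall z, P z.2}.
Proof. exact: negligible_snd. Qed.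

(** The box is shifted along the main diagonal: its coordinates are at least [K + 2], those of
    points of [Omega] are below [K + 1]. Having positive measure, it contains a point satisfying any
    given almost everywhere property. *)
Lemma bounded_disjoint_box (Omega : set 'rV[R]_N) : (0 < N)%N -> bounded_set Omega ->
  exists c, forall x, box c 1 x -> ~ Omega x.
Proof.
move=> N0 [M [Mr hM]]; pose K := Num.max M 0 + 1.
have MK : M < K by rewrite /K ltr_pwDr// le_max lexx.
have K0 : 0 < K by rewrite /K ltr_wpDl// le_max lexx orbT.
exists (const_mx (K + 3)) => x xB /(hM _ MK) xK.
have : ball (0 : 'rV[R]_N) (K + 1) x.
  by rewrite -ball_normE /= sub0r normrN (le_lt_trans xK)// ltrDl.
move=> /ball_rVP[_ /(_ (Ordinal N0))]; have := xB (Ordinal N0); rewrite !mxE sub0r normrN.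
by rewrite ler_norml ltr_norml => /andP[? ?] /andP[? ?]; lra.
Qed.

Lemma ae_exists_box (c : 'rV[R]_N) (P : 'rV[R]_N -> Prop) :
  {ae mu, forall x, P x} -> exists2 y, box c 1 y & P y.
Proof.
move=> aeP; apply/not_exists2P => h.
have : mu.-negligible (box c 1).
  by apply: negligibleS aeP => x xB /= Px; have := h x; tauto.
move/(negligibleP _ (measurable_box c 1)) => h0; have := lebesgue_box c (@ler01 R); rewrite [LHS]h0.
by move=> [/esym/eqP]; rewrite mulr1 expf_eq0 pnatr_eq0 andbF.
Qed.

Lemma enorm_gt0 (x y : 'rV[R]_N) : x != y -> 0 < enorm (x - y).
Proof.
move=> xy; rewrite lt_neqAle enorm_ge0 andbT; apply: contra_neq xy => /esym e0.
apply/rowP => i; have := coord_le_enorm (x - y) i.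
by rewrite e0 normr_le0 !mxE subr_eq0 => /eqP.
Qed.

End almost_everywhere_product.

(** * From small seminorms to almost everywhere convergence *)

Section gagliardo_convergence.
Context {R : realType} {N : nat}.
Local Notation mu := (@lebesgue_rV R N).
Variables s p : R.
Hypothesis p_gt0 : 0 < p.
Local Notation E := (N%:R + s * p).
Local Notation dens f := (gagliardo_density s p f).

Lemma gagliardo_norm_lty (u : 'rV[R]_N -> R) : (gagliardo_norm s p u < +oo)%E ->
  (\int[mu \x mu]_z (dens u z)%:E < +oo)%E.
Proof. by apply: lty_poweRy; rewrite gt_eqF// invr_gt0. Qed.

(** Indices are picked independently for each [k], with no monotonicity of [sg]: only summability of
    the selected integrals matters afterwards. *)
Lemma gagliardo_norm_subseq (v : nat -> 'rV[R]_N -> R) (e : nat -> R) :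
  (forall k, 0 < e k) ->
  gagliardo_norm s p (v n) @[n --> \oo] --> 0%E ->
  exists sg : nat -> nat, forall k,
    (\int[mu \x mu]_z (dens (v (sg k)) z)%:E <= (e k)%:E)%E.
Proof.
move=> e0 cv.
suff h k : exists n, (\int[mu \x mu]_z (dens (v n) z)%:E <= (e k)%:E)%E.
  by exists (fun k => sval (cid (h k))) => k; case: cid.
have ep : 0 < e k `^ p^-1 by rewrite powR_gt0.
have [n _ /(_ n (leqnn n))] : \forall n \near \oo, (gagliardo_norm s p (v n) < (e k `^ p^-1)%:E)%E.
  by apply: (cv [set y | (y < _)%E]); apply: open_ereal_lt'; rewrite lte_fin.
move=> /= hn; exists n; rewrite leNgt; apply/negP => lt.
move: hn; rewrite ltNge -poweR_EFin => /negP; apply.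
apply: gt0_ler_poweR; rewrite ?invr_ge0 ?(ltW p_gt0)//; last exact: ltW.
- by rewrite in_itv/= leey lee_fin ltW.
- rewrite in_itv/= leey andbT; apply: integral_ge0 => z _.
  by rewrite lee_fin gagliardo_density_ge0.
Qed.

(** As in the Riesz-Fischer argument, this sum serves twice: its finiteness forces pointwise
    convergence, and it is one integrable majorant of all the densities. *)
Definition dens_series (v : nat -> 'rV[R]_N -> R) z : \bar R := (\sum_(k <oo) (dens (v k) z)%:E)%E.

Variable v : nat -> 'rV[R]_N -> R.
Hypothesis mv : forall k, measurable_fun setT (v k).
Hypothesis v_small : forall k, (\int[mu \x mu]_z (dens (v k) z)%:E <= (1 * 2^-1 ^+ k)%:E)%E.

Lemma dens_series_ge0 z : (0 <= dens_series v z)%E.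
Proof. by apply: nneseries_ge0 => k _ _; rewrite lee_fin gagliardo_density_ge0. Qed.

Lemma dens_le_series k z : ((dens (v k) z)%:E <= dens_series v z)%E.
Proof.
have d0 i : (0 <= (dens (v i) z)%:E)%E by rewrite lee_fin gagliardo_density_ge0.
apply: (@le_trans _ _ (\sum_(0 <= i < k.+1) (dens (v i) z)%:E)%E); last exact: nneseries_lim_ge.
by rewrite big_nat_recr//= -[leLHS]add0e leeD//; exact: sume_ge0.
Qed.

Lemma measurable_dens_EFin (f : 'rV[R]_N -> R) : measurable_fun setT f ->
  measurable_fun setT (fun z => (dens f z)%:E).
Proof. by move=> mf; apply/measurable_EFinP; exact: measurable_gagliardo_density. Qed.

Lemma integrable_dens (f : 'rV[R]_N -> R) : measurable_fun setT f ->
  (\int[mu \x mu]_z (dens f z)%:E < +oo)%E -> (mu \x mu)%E.-integrable setT (fun z => (dens f z)%:E).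
Proof.
move=> mf fo; apply/integrableP; split; first exact: measurable_dens_EFin.
by under eq_integral do rewrite gee0_abs ?lee_fin ?gagliardo_density_ge0//.
Qed.

Lemma integrable_dens_series : (mu \x mu)%E.-integrable setT (dens_series v).
Proof.
apply/integrableP; split.
  apply: ge0_emeasurable_sum => *; last exact: measurable_dens_EFin.
  by rewrite lee_fin gagliardo_density_ge0.
under eq_integral do rewrite gee0_abs ?dens_series_ge0//.
rewrite integral_nneseries//; last 2 first.
- by move=> k; exact: measurable_dens_EFin.
- by move=> k z _; rewrite lee_fin gagliardo_density_ge0.
apply: le_lt_trans (@nneseries_geometric_lty R 1 2^-1 _); last first.
  by rewrite invr_ge0 ler0n/= invf_lt1// ltr1n.
apply: lee_nneseries => [k _ _|k _]; last exact: v_small.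
by apply: integral_ge0 => z _; rewrite lee_fin gagliardo_density_ge0.
Qed.

Lemma dens_series_cvg0 z : (dens_series v z < +oo)%E -> z.1 != z.2 ->
  v k z.1 - v k z.2 @[k --> \oo] --> 0.
Proof.
move=> So z12; have en0 := enorm_gt0 z12.
have Sfin : dens_series v z \is a fin_num.
  by rewrite ge0_fin_numE// dens_series_ge0.
have c0 : dens (v k) z @[k --> \oo] --> 0.
  apply: cvg_series_cvg_0; apply: nondecreasing_is_cvgn.
    apply/nondecreasing_seqP => n; rewrite /series /= big_nat_recr//= lerDl.
    exact: gagliardo_density_ge0.
  exists (fine (dens_series v z)) => _ [n _ <-].
  rewrite -lee_fin fineK// /series /= -sumEFin.
  by apply: nneseries_lim_ge => i _ _; rewrite lee_fin gagliardo_density_ge0.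
have EE : 0 < enorm (z.1 - z.2) `^ E by rewrite powR_gt0.
apply/cvgr0Pnorm_lt => e e0.
have : \forall k \near \oo, dens (v k) z < e `^ p / enorm (z.1 - z.2) `^ E.
  by move/cvgr_lt : c0; apply; rewrite divr_gt0 ?powR_gt0.
apply: filterS => k; rewrite ltr_pdivrMr ?divr_gt0 ?powR_gt0// divfK ?gt_eqF//.
apply: contraTT; rewrite -!leNgt => ek.
by apply: ge0_ler_powR; rewrite ?nnegrE ?(ltW e0) ?(ltW p_gt0).
Qed.

(* An increment v k x - v k y with y outside Omega is v k x, so Fubini turns the
   convergence of increments into convergence of v k itself. *)
Lemma dens_series_ae_cvg0 (Omega : set 'rV[R]_N) : (0 < N)%N -> bounded_set Omega ->
  {ae mu, forall x, ~ Omega x -> forall k, v k x = 0} ->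
  {ae mu, forall x, v k x @[k --> \oo] --> 0}.
Proof.
move=> N0 bO v0; have [c hc] := bounded_disjoint_box N0 bO.
have v0c := v0; have := ae_integrable1 integrable_dens_series.
apply: filterS2 v0c => x v0x /(integrable_ae measurableT) Sx.
have [Ox|/v0x nOx] := pselect (Omega x); last first.
  by rewrite (_ : (fun k => v k x) = cst 0) ?funeqE//; exact: cvg_cst.
have : {ae mu, forall y, dens_series v (x, y) \is a fin_num /\ (~ Omega y -> forall k, v k y = 0)}.
  apply: filterS2 Sx v0 => y /(_ I) h1 h2; split => //.
move=> /(ae_exists_box c)[y /hc nOy [Sy /(_ nOy) vy]].
have xy : x != y by apply/eqP => xy; apply: nOy; rewrite -xy.
have := @dens_series_cvg0 (x, y) _ xy.
under eq_fun do rewrite /= vy subr0.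
by apply; rewrite ltey_eq Sy.
Qed.

End gagliardo_convergence.

(** * Passage to the limit in the test functions *)

Section cutoff_form.
Context {R : realType} {N : nat}.
Local Notation mu := (@lebesgue_rV R N).
Local Notation mu2 := (mu \x mu)%E.
Variables s p : R.
Hypothesis p_gt1 : 1 < p.
Local Notation E := (N%:R + s * p).
Local Notation dens f := (gagliardo_density s p f).
Implicit Types f phi eta : 'rV[R]_N -> R.

Let p_gt0 : 0 < p. Proof. exact: lt_trans p_gt1. Qed.

Variable u : 'rV[R]_N -> R.
Hypothesis mu_u : measurable_fun setT u.
Hypothesis u_fin : (\int[mu \x mu]_z (dens u z)%:E < +oo)%E.

Definition weight (z : 'rV[R]_N * 'rV[R]_N) : R :=
  signed_power p (u z.1 - u z.2) / enorm (z.1 - z.2) `^ E.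

Definition cutoff_test eta phi (j : R) (x : 'rV[R]_N) : R := eta x * cutoff j (phi x).

Lemma measurable_incr f : measurable_fun setT f ->
  measurable_fun setT (fun z : 'rV[R]_N * 'rV[R]_N => f z.1 - f z.2).
Proof.
by move=> mf; apply: measurable_funB; [exact: measurable_comp_fst|exact: measurable_comp_snd].
Qed.

Lemma measurable_weight : measurable_fun setT weight.
Proof.
apply: measurable_funM; last exact: measurable_kernel.
apply: measurable_funM; last exact: measurable_incr.
apply: (measurableT_comp (measurable_powR _)); apply: measurableT_comp => //.
exact: measurable_incr.
Qed.

Lemma measurable_cutoff_test eta phi j : measurable_fun setT eta -> measurable_fun setT phi ->
  measurable_fun setT (cutoff_test eta phi j).
Proof.
move=> me mp; apply: measurable_funM => //.
by apply: (measurableT_comp _ mp); apply: continuous_measurable_fun; exact: continuous_cutoff.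
Qed.

Lemma weight_mul_le f z : `|weight z| * `|f z.1 - f z.2| <= dens u z + dens f z.
Proof.
rewrite /weight /gagliardo_density normrM mulrAC -mulrDl.
rewrite [X in _ * X <= _]ger0_norm ?invr_ge0 ?powR_ge0//.
by rewrite ler_wpM2r ?invr_ge0 ?powR_ge0// signed_power_young.
Qed.

(** The increment of [phi] is split into those of [u] and [phi - u], so that [phi] enters only
    through the small density. The weight against the increments of [eta], [u] and [phi - u] yields
    [dens u] once, twice and once, the last two multiplied by [|j|]; hence [1 + 3 |j|]. *)
Lemma cutoff_form_bound eta phi j z : (forall x, 0 <= eta x <= 1) ->
  `|weight z * (cutoff_test eta phi j z.1 - cutoff_test eta phi j z.2)| <=
  (1 + 3 * `|j|) * dens u z + dens eta z + `|j| * dens (phi \- u) z.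
Proof.
move=> e01; rewrite normrM.
apply: (@le_trans _ _ (`|weight z| * (`|eta z.1 - eta z.2| + `|j| *
    (`|u z.1 - u z.2| + `|(phi \- u) z.1 - (phi \- u) z.2|)))).
  rewrite ler_wpM2l//; apply: le_trans (cutoff_diff_le _ _ _ (e01 _) (e01 _)) _.
  rewrite lerD2l ler_wpM2l//.
  have -> : phi z.1 - phi z.2 = (u z.1 - u z.2) + ((phi \- u) z.1 - (phi \- u) z.2).
    by rewrite /=; ring.
  exact: ler_normD.
have h1 := weight_mul_le eta z; have h2 := weight_mul_le u z.
have h3 := weight_mul_le (phi \- u) z.
have j0 := normr_ge0 j.
rewrite mulrDr mulrCA mulrDr.
have h4 := lerD h2 h3.
have := ler_wpM2l j0 h4.
move: h1 => /=; lra.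
Qed.

Lemma integrable_cutoff_form eta j : (forall x, 0 <= eta x <= 1) ->
  measurable_fun setT eta -> (\int[mu \x mu]_z (dens eta z)%:E < +oo)%E ->
  mu2.-integrable setT
    (fun z => (weight z * (cutoff_test eta u j z.1 - cutoff_test eta u j z.2))%:E).
Proof.
move=> e01 me eoo.
have iu := integrable_dens mu_u u_fin.
have ie := integrable_dens me eoo.
apply: (@le_integrable _ _ _ _ _ measurableT _
  (fun z => ((1 + 3 * `|j|)%:E * (dens u z)%:E + (dens eta z)%:E)%E)).
- apply/measurable_EFinP; apply: measurable_funM; first exact: measurable_weight.
  by apply: measurable_incr; exact: measurable_cutoff_test.
- move=> z _; rewrite -EFinM -EFinD !abse_EFin lee_fin [leRHS]ger0_norm; last first.
    have j0 : 0 <= 1 + 3 * `|j| by rewrite addr_ge0// mulr_ge0.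
    by apply: addr_ge0; [apply: mulr_ge0 j0 _|]; exact: gagliardo_density_ge0.
  (* Used with [phi = u], so the density of [phi - u] is zero. *)
  apply: le_trans (cutoff_form_bound u j z e01) _.
  rewrite gerDl (_ : dens _ z = 0) ?mulr0//.
  by rewrite /gagliardo_density /= !subrr normr0 powR0 ?mul0r// gt_eqF.
- by apply: integrableD => //; exact: integrableZl.
Qed.

Lemma cutoff_form_ge0 (Omega : set 'rV[R]_N) (phi : nat -> 'rV[R]_N -> R) eta j :
  (0 < N)%N -> bounded_set Omega ->
  {ae mu, forall x, ~ Omega x -> u x = 0} ->
  (forall n, measurable_fun setT (phi n)) ->
  (forall n x, ~ Omega x -> phi n x = 0) ->
  gagliardo_norm s p (phi n \- u) @[n --> \oo] --> 0%E ->
  (forall x, 0 <= eta x <= 1) ->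
  measurable_fun setT eta -> (\int[mu \x mu]_z (dens eta z)%:E < +oo)%E ->
  (forall n, (0 <= frac_plaplacian_form s p u (cutoff_test eta (phi n) j))%E) ->
  (0 <= frac_plaplacian_form s p u (cutoff_test eta u j))%E.
Proof.
move=> N0 bO u0 mphi phi0 cphi e01 me eoo form_ge0.
have [|sg hsg] := @gagliardo_norm_subseq _ _ s p p_gt0 (fun n => phi n \- u) (fun k => 1 * 2^-1 ^+ k) _ cphi.
  by move=> k; rewrite mul1r exprn_gt0// invr_gt0.
pose v k := phi (sg k) \- u.
have mv k : measurable_fun setT (v k) by exact: measurable_funB.
have iS : mu2.-integrable setT (dens_series s p v) by exact: integrable_dens_series.
have iu := integrable_dens mu_u u_fin.
have ie := integrable_dens me eoo.
have cv : {ae mu, forall x, phi (sg k) x @[k --> \oo] --> u x}.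
  have : {ae mu, forall x, v k x @[k --> \oo] --> 0}.
    apply: (dens_series_ae_cvg0 p_gt0 mv hsg N0 bO).
    by apply: filterS u0 => x ux nOx k; rewrite /v /= phi0// ux// subrr.
  apply: filterS => x cx.
  have : v k x + u x @[k --> \oo] --> 0 + u x by apply: cvgD; [exact: cx|exact: cvg_cst].
  by rewrite add0r; under eq_fun do rewrite /v /= subrK.
pose f_ k z := (weight z * (cutoff_test eta (phi (sg k)) j z.1 - cutoff_test eta (phi (sg k)) j z.2))%:E.
pose f z := (weight z * (cutoff_test eta u j z.1 - cutoff_test eta u j z.2))%:E.
(* The pointwise bound with its only [k]-dependent term replaced by the whole series. *)
pose g z := ((1 + 3 * `|j|)%:E * (dens u z)%:E + (dens eta z)%:E + `|j|%:E * dens_series s p v z)%E.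
have mf h : measurable_fun setT h -> measurable_fun setT
    (fun z => (weight z * (cutoff_test eta h j z.1 - cutoff_test eta h j z.2))%:E).
  move=> mh; apply/measurable_EFinP; apply: measurable_funM; first exact: measurable_weight.
  by apply: measurable_incr; exact: measurable_cutoff_test.
have cc x : phi (sg k) x @[k --> \oo] --> u x ->
    cutoff_test eta (phi (sg k)) j x @[k --> \oo] --> cutoff_test eta u j x.
  move=> cx; apply: cvgM; first exact: cvg_cst.
  exact: (cvg_comp _ (cutoff j) cx (@continuous_cutoff R j (u x))).
have [|||_ _ c] := @dominated_convergence _ _ _ mu2 setT measurableT f_ f g
  (fun k => mf _ (mphi (sg k))) (mf _ mu_u).
- apply: filterS2 (ae_fst cv) (ae_snd cv) => z c1 c2 _.
  apply: cvg_EFin; first exact: nearW.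
  apply: cvgM; first exact: cvg_cst.
  by apply: cvgB; exact: cc.
- by apply: integrableD => //; [apply: integrableD => //; exact: integrableZl|exact: integrableZl].
- apply: aeW => z k _; rewrite abse_EFin.
  apply: (@le_trans _ _ ((1 + 3 * `|j|)%:E * (dens u z)%:E + (dens eta z)%:E + `|j|%:E * (dens (v k) z)%:E)%E).
    by rewrite -!EFinM -!EFinD lee_fin cutoff_form_bound.
  by rewrite leeD2l// lee_wpmul2l ?lee_fin//; exact: dens_le_series.
apply: cvge_ge c; apply: nearW => k.
exact: form_ge0.
Qed.

End cutoff_form.

(** * The zero set and the positivity set *)

Section vanishing_set.
Context {R : realType} {N : nat}.
Local Notation mu := (@lebesgue_rV R N).
Local Notation mu2 := (mu \x mu)%E.
Variables s p : R.
Hypothesis p_gt1 : 1 < p.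
Local Notation dens f := (gagliardo_density s p f).

Let p_gt0 : 0 < p. Proof. exact: lt_trans p_gt1. Qed.

Variables u eta : 'rV[R]_N -> R.
Hypothesis mu_u : measurable_fun setT u.
Hypothesis u_fin : (\int[mu \x mu]_z (dens u z)%:E < +oo)%E.
Hypothesis eta01 : forall x, 0 <= eta x <= 1.
Hypothesis meta : measurable_fun setT eta.
Hypothesis eta_fin : (\int[mu \x mu]_z (dens eta z)%:E < +oo)%E.
Local Notation w := (weight s p u).

Let defect n z := `|w z| * `|eta z.1 - eta z.2| * cutoff n%:R (u z.1 - u z.2).
Let form n z := w z * (cutoff_test eta u n%:R z.1 - cutoff_test eta u n%:R z.2).
Let posset : set 'rV[R]_N := [set x | 0 < u x].
Let zeroset : set 'rV[R]_N := [set x | u x = 0 /\ 0 < eta x].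
Let gain z := w z * eta z.2 * (1 - cutoff 1 (u z.1)) * \1_(posset `*` zeroset) z.

Lemma weight_ge0 z : u z.2 <= u z.1 -> 0 <= w z.
Proof. by move=> h; rewrite divr_ge0 ?powR_ge0// signed_power_ge0 // subr_ge0. Qed.

Lemma weight_sym x y : w (y, x) = - w (x, y).
Proof.
rewrite /weight /= -opprB signed_powerN mulNr; congr (- (_ / _ `^ _)).
by rewrite /enorm; congr Num.sqrt; apply: eq_bigr => i _; rewrite !mxE; ring.
Qed.

(** The left side collapses to [w (eta(x) - eta(y)) F_n(u(x))] with [w >= 0]. Nonnegativity of
    [u(y)] gives [u(x) - u(y) <= u(x)], so [F_n(u(x)) <= F_n(u(x) - u(y))]. *)
Lemma form_le_of_le n x y : 0 <= u y -> u y <= u x ->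
  form n (x, y) + w (x, y) * eta y * (cutoff n%:R (u y) - cutoff n%:R (u x)) <=
  defect n (x, y).
Proof.
move=> uy uyx; have w0 := @weight_ge0 (x, y) uyx.
rewrite /form /defect /cutoff_test /= [`|w _|]ger0_norm//.
rewrite (_ : _ + _ = w (x, y) * ((eta x - eta y) * cutoff n%:R (u x))); last by ring.
rewrite -mulrA ler_wpM2l//.
apply: (@le_trans _ _ (`|eta x - eta y| * cutoff n%:R (u x))).
  by rewrite ler_wpM2r ?ler_norm// ltW// cutoff_gt0.
rewrite ler_wpM2l//; apply: cutoff_anti; rewrite !ger0_norm ?subr_ge0//; first by rewrite gerBl.
exact: le_trans uyx.
Qed.

Lemma gain_le_defect n x y : (0 < n)%N -> 0 <= u x -> 0 <= u y ->
  gain (x, y) <= defect n (x, y) - form n (x, y).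
Proof.
move=> n0 ux uy; rewrite lerBrDr /gain indicE; have [yx|xy] := leP (u y) (u x).
  have w0 := @weight_ge0 (x, y) yx.
  apply: le_trans (form_le_of_le n uy yx); rewrite addrC lerD2l /=.
  have /andP[e0 _] := eta01 y.
  case: (boolP (_ \in _)) => [/set_mem[/= px [zy ey]]|_]; rewrite ?mulr1 ?mulr0.
    rewrite zy cutoff0; apply: (ler_wpM2l (mulr_ge0 w0 e0)); rewrite lerD2l lerN2.
    by apply: cutoff_anti_scale; rewrite ler01 ler1n.
  apply: (mulr_ge0 (mulr_ge0 w0 e0)); rewrite subr_ge0; apply: cutoff_anti.
  by rewrite !ger0_norm.
(* When [u x < u y] the pair is outside the rectangle and [gain] vanishes; [form] and [defect] are
   symmetric, so the ordered case applies with the points exchanged. *)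
rewrite memNset ?mulr0 ?add0r; last by move=> -[/= px [zy _]]; move: xy; rewrite zy ltNge (ltW px).
have := form_le_of_le n ux (ltW xy).
have -> : form n (y, x) = form n (x, y).
  by rewrite /form weight_sym /=; ring.
have -> : defect n (y, x) = defect n (x, y).
  rewrite /defect weight_sym normrN /= distrC; congr (_ * _).
  by rewrite /cutoff -opprB mulrN sqrrN.
apply: le_trans; rewrite lerDl; have /andP[e0 _] := eta01 x.
apply: (mulr_ge0 (mulr_ge0 (@weight_ge0 (y, x) (ltW xy)) e0)).
by rewrite subr_ge0; apply: cutoff_anti; rewrite !ger0_norm// ltW.
Qed.

Lemma gain_ge0 z : 0 <= gain z.
Proof.
rewrite /gain indicE; case: (boolP (_ \in _)) => [/set_mem[/= px [zy ey]]|_]; last by rewrite mulr0.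
have w0 : 0 <= w z by apply: weight_ge0; rewrite zy ltW.
by rewrite mulr1; apply: (mulr_ge0 (mulr_ge0 w0 (ltW ey))); rewrite subr_ge0 cutoff_le1.
Qed.

Let mpos : measurable posset.
Proof.
rewrite (_ : posset = u @^-1` [set` `]0, +oo[]).
  by rewrite -[X in measurable X]setTI; exact: mu_u.
by apply/seteqP; split => x; rewrite /posset /= in_itv/= andbT.
Qed.

Let mzero : measurable zeroset.
Proof.
rewrite (_ : zeroset = (u @^-1` [set 0]) `&` (eta @^-1` [set` `]0, +oo[])).
  apply: measurableI; rewrite -[X in measurable X]setTI; last exact: meta.
  by apply: mu_u.
by apply/seteqP; split => x; rewrite /zeroset /= in_itv/= andbT.
Qed.

Lemma measurable_gain : measurable_fun setT gain.
Proof.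
apply: measurable_funM; last by apply: measurable_indic; exact: measurableX.
apply: measurable_funM.
  apply: measurable_funM; first exact: measurable_weight.
  exact: measurable_comp_snd.
apply: measurable_funB => //; apply: (measurable_comp_fst (f := fun x => cutoff 1 (u x))).
by apply: (measurableT_comp _ mu_u); apply: continuous_measurable_fun; exact: continuous_cutoff.
Qed.

Lemma measurable_defect n : measurable_fun setT (defect n).
Proof.
apply: measurable_funM.
  apply: measurable_funM; apply: measurableT_comp => //; first exact: measurable_weight.
  exact: measurable_incr.
apply: (measurableT_comp _ (measurable_incr mu_u)).
by apply: continuous_measurable_fun; exact: continuous_cutoff.
Qed.

Lemma defect_le n z : `|defect n z| <= dens u z + dens eta z.
Proof.
apply: le_trans (weight_mul_le s p_gt1 u eta z).
rewrite /defect normrM normrM !normr_id ler_piMr ?mulr_ge0//.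
by rewrite ger0_norm ?cutoff_le1// ltW// cutoff_gt0.
Qed.

Let idom : mu2.-integrable setT (fun z => (dens u z)%:E + (dens eta z)%:E)%E.
Proof. by apply: integrableD => //; exact: integrable_dens. Qed.

Lemma integrable_defect n : mu2.-integrable setT (fun z => (defect n z)%:E).
Proof.
apply: le_integrable idom => //.
  by apply/measurable_EFinP; exact: measurable_defect.
move=> z _; rewrite -EFinD !abse_EFin lee_fin (le_trans (defect_le n z))//.
exact: ler_norm.
Qed.

(** Where [u(x) = u(y)] the cutoff stays equal to 1, but there the weight is zero; elsewhere the
    cutoff tends to 0. *)
Lemma defect_integral_cvg0 : (\int[mu2]_z (defect n z)%:E)%E @[n --> \oo] --> 0%E.
Proof.
have [|||||_ _] := @dominated_convergence _ _ _ mu2 setT measurableT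
  (fun n z => (defect n z)%:E) (fun=> 0%E) (fun z => (dens u z)%:E + (dens eta z)%:E)%E.
- by move=> n; apply/measurable_EFinP; exact: measurable_defect.
- exact: measurable_cst.
- apply: aeW => z _; apply: cvg_EFin; first exact: nearW.
  have [u0|u0] := eqVneq (u z.1 - u z.2) 0.
    rewrite (_ : fine \o _ = cst 0); first exact: cvg_cst.
    by apply/funext => n /=; rewrite /defect /weight u0 signed_power0 mul0r normr0 !mul0r.
  have c : defect n z @[n --> \oo] --> `|w z| * `|eta z.1 - eta z.2| * 0.
    by apply: cvgMl_tmp; exact: cutoff_cvg0.
  by move: c; rewrite mulr0.
- exact: idom.
- by apply: aeW => z n _; rewrite -EFinD abse_EFin lee_fin; exact: defect_le.
by rewrite integral0.
Qed.

Lemma negligible_pos_or_zero : {ae mu, forall x, 0 <= u x} ->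
  (forall n, (0 <= frac_plaplacian_form s p u (cutoff_test eta u n%:R))%E) ->
  mu.-negligible [set x | 0 < u x] \/ mu.-negligible [set x | u x = 0 /\ 0 < eta x].
Proof.
move=> u0 form0.
have iform n : mu2.-integrable setT (fun z => (form n z)%:E) by exact: integrable_cutoff_form.
have gain_int n : (\int[mu2]_z (gain z)%:E <= \int[mu2]_z (defect n.+1 z)%:E)%E.
  (* The difference is known to be nonnegative only almost everywhere, as [u] is. The absolute value
     gives an integrand nonnegative everywhere for the comparison, and is removed afterwards. The
     index [n.+1] meets the condition [0 < n] of [gain_le_defect]. *)
  apply: (@le_trans _ _ (\int[mu2]_z `|(defect n.+1 z)%:E - (form n.+1 z)%:E|)%E).
    apply: ae_ge0_le_integral => //.
    - by move=> z _; rewrite lee_fin gain_ge0.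
    - by apply/measurable_EFinP; exact: measurable_gain.
    - apply: measurableT_comp => //; apply: emeasurable_funB.
        exact: measurable_int (integrable_defect _).
      exact: measurable_int (iform _).
    apply: filterS2 (ae_fst u0) (ae_snd u0) => -[x y] /= ux uy _.
    rewrite lee_fin; apply: le_trans (ler_norm _).
    exact: gain_le_defect.
  have -> : (\int[mu2]_z `|(defect n.+1 z)%:E - (form n.+1 z)%:E| =
      \int[mu2]_z ((defect n.+1 z)%:E - (form n.+1 z)%:E))%E.
    apply: ae_eq_integral => //.
    - apply: measurableT_comp => //; apply: emeasurable_funB.
        exact: measurable_int (integrable_defect _).
      exact: measurable_int (iform _).
    - apply: emeasurable_funB.
        exact: measurable_int (integrable_defect _).
      exact: measurable_int (iform _).
    apply: filterS2 (ae_fst u0) (ae_snd u0) => -[x y] /= ux uy _.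
    rewrite ger0_norm//; apply: le_trans (gain_le_defect _ ux uy) => //.
    exact: gain_ge0.
  rewrite integralB//; last exact: integrable_defect.
  by rewrite -[leRHS]sube0 leeB//; exact: form0.
have gain0 : (\int[mu2]_z (gain z)%:E <= 0)%E.
  have c : (\int[mu2]_z (defect n.+1 z)%:E)%E @[n --> \oo] --> 0%E.
    by have := defect_integral_cvg0; rewrite -cvg_shiftS.
  by apply: cvge_ge c; exact: nearW.
have gainE : (\int[mu2]_z `|(gain z)%:E| = 0)%E.
  under eq_integral do rewrite gee0_abs ?lee_fin ?gain_ge0//.
  by apply/eqP; rewrite eq_le gain0 integral_ge0// => z _; rewrite lee_fin gain_ge0.
have := (ae_eq_integral_abs mu2 measurableT ((measurable_EFinP _ _).2 measurable_gain)).1 gainE.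
move=> nul.
have nulA : mu2.-negligible (posset `*` zeroset).
  (* On the rectangle [gain] is strictly positive: [u(x) > 0 = u(y)] forces [x != y], a positive
     weight, and [F_1(u(x)) < 1]. *)
  apply: negligibleS nul => -[x y] [/= px [zy ey]] /(_ I) /= [].
  apply/eqP; rewrite gt_eqF// /gain indicE mem_set ?mulr1//=.
  have w0 : 0 < w (x, y).
    rewrite divr_gt0//; first by apply: signed_power_gt0; rewrite /= zy subr0.
    apply: powR_gt0; apply: enorm_gt0; apply/eqP => /= xy.
    by move: px; rewrite /posset /= xy zy ltxx.
  apply: (mulr_gt0 (mulr_gt0 w0 ey)).
  rewrite subr_gt0 invf_lt1 ?cutoff_den_gt0// ltrDl mul1r exprn_even_gt0//=.
  by rewrite gt_eqF.
have := (negligibleP _ (measurableX mpos mzero)).1 nulA.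
rewrite [LHS](product_measure1E mu mu mpos mzero) => /eqP; rewrite mule_eq0.
by move=> /orP[] /eqP h; [left|right]; apply/negligibleP.
Qed.

End vanishing_set.

(** * Admissibility of the approximating tests, and the conclusion *)

Section admissible_tests.
Context {R : realType} {N : nat}.

Lemma smooth_expr_cutoff_test (c : 'rV[R]_N) (a j : R) (phi : 'rV[R]_N -> R) :
  smooth phi -> smooth_expr (cutoff_test (bump c a) phi j).
Proof.
move=> sphi; apply: smooth_exprM; first exact: smooth_expr_bump.
apply: smooth_exprV; last by move=> x; rewrite gt_eqF ?cutoff_den_gt0.
apply: smooth_exprD; first exact: smooth_expr_cst.
under eq_fun do rewrite expr2.
by apply: smooth_exprM; (apply: smooth_exprM; [exact: smooth_expr_cst|exact: smooth_expr_smooth]).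
Qed.

Lemma test_function_measurable (Omega : set 'rV[R]_N) (phi : 'rV[R]_N -> R) :
  test_function Omega phi -> measurable_fun setT phi.
Proof. by move=> [sphi _ _]; apply: continuous_rV_measurable; have [] := sphi [::]. Qed.

Lemma test_function_out (Omega : set 'rV[R]_N) (phi : 'rV[R]_N -> R) x :
  test_function Omega phi -> ~ Omega x -> phi x = 0.
Proof.
move=> [_ _ sub] nOx; apply/eqP/negPn/negP => px; apply: nOx; apply: sub.
exact: subset_closure.
Qed.

End admissible_tests.

Unset Implicit Arguments.

Theorem theoremA1 (R : realType) (N : nat) (N_gt0 : (0 < N)%N)
    (Omega : set 'rV[R]_N)
    (Omega_open : open Omega) (Omega_bounded : bounded_set Omega)
    (Omega_connected : connected Omega)
    (s p : R) (s_gt0 : 0 < s) (s_lt1 : s < 1) (p_gt1 : 1 < p)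
    (u : 'rV[R]_N -> R)
    (u_sobolev : sobolev0 s p Omega u)
    (u_super : weak_supersolution s p Omega u)
    (u_ge0 : {ae lebesgue_rV N, forall x, Omega x -> 0 <= u x})
    (u_neq0 : ~ {ae lebesgue_rV N, forall x, Omega x -> u x = 0}) :
  {ae lebesgue_rV N, forall x, Omega x -> 0 < u x}.
Proof.
have p_gt0 : 0 < p by exact: lt_trans p_gt1.
have [mes_u u_out u_norm [phi [phi_test phi_cvg]]] := u_sobolev.
have u_fin := gagliardo_norm_lty p_gt0 u_norm.
have u_nneg : {ae lebesgue_rV N, forall x, 0 <= u x}.
  apply: filterS2 u_ge0 u_out => x ux0 uxO.
  by have [/ux0//|/uxO ->] := pselect (Omega x).
have NR : 1 <= N%:R :> R by rewrite ler1n.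
suff : (lebesgue_rV N).-negligible ([set x | u x = 0] `&` Omega).
  move=> nz; have {}nz : {ae lebesgue_rV N, forall x, ~ (u x = 0 /\ Omega x)}.
    by apply: negligibleS nz => x /= /contrapT.
  apply: filterS2 u_nneg nz => x ux nx Ox; rewrite lt_neqAle ux andbT eq_sym.
  by apply/eqP => u0; exact: nx.
(* The factor [N] covers the support of a bump positive on [ball c r], the factor 2 its closure. *)
apply: (negligible_open_cover (l := 2 * N%:R) Omega_open) => [|c r r0 cO]; first by lra.
pose a := N%:R * r ^+ 2.
have a0 : 0 <= a by rewrite mulr_ge0// sqr_ge0.
have bump01 x : 0 <= bump c a x <= 1 by rewrite bump_ge0 bump_le1.
have mb := measurable_bump c a.
have bump_fin := bump_gagliardo_lty s_gt0 s_lt1 p_gt0 c a0.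
have tests n (j : R) : test_function Omega (cutoff_test (bump c a) (phi n) j).
  apply: (@test_function_ball _ _ _ c (N%:R * r)).
  - by rewrite mulr_gt0// ltr0n.
  - by have [sphi _ _] := phi_test n; exact: smooth_expr_cutoff_test.
  - move=> x; rewrite mulf_eq0 negb_or => /andP[bx _].
    exact: bump_neq0_ball.
  - by rewrite mulrA.
have form0 n : (0 <= frac_plaplacian_form s p u (cutoff_test (bump c a) u n%:R))%E.
  apply: (cutoff_form_ge0 (phi := phi) p_gt1 mes_u u_fin N_gt0 Omega_bounded u_out) => //.
  - by move=> k; exact: test_function_measurable.
  - by move=> k x; exact: test_function_out.
  - move=> k; apply: u_super => // x.
    by rewrite mulr_ge0 ?bump_ge0// ltW// cutoff_gt0.
(* A null positivity set would make [u] vanish almost everywhere; otherwise the zeros where the bump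
   is positive, in particular those in [ball c r], form a null set. *)
have [pos|] := negligible_pos_or_zero p_gt1 mes_u u_fin bump01 mb bump_fin u_nneg form0.
  exfalso; apply: u_neq0.
  have {}pos : {ae lebesgue_rV N, forall x, ~ 0 < u x}.
    by apply: negligibleS pos => x /= /contrapT.
  apply: filterS2 u_nneg pos => x ux /negP; rewrite -leNgt => ux' _.
  by apply/eqP; rewrite eq_le ux ux'.
apply: negligibleS => x /= [ux cx]; split => //.
exact: ball_bump_gt0.
Qed.
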